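(* Let $(B,\hat B,\pi)$ be an extension triple such that $\pi$ is at most $2$-to-$1$, that is, $|\pi^{-1}\alpha|\le2$ for all $\alpha\in X_B$. Then $$S_D=\big[0,\sup_{\mu\in\mathcal M}\mu(D)\big],$$ where $\mathcal M$ is the collection of all invariant measures of $(X_B,\phi_B)$ and $S_D$ is the Birkhoff spectrum of $(B,\hat B,\pi)$.
   Context: **Bratteli diagrams.** A Bratteli diagram $B=(V,E)$ is an infinite graph with vertices $V=\bigsqcup_{n\ge0}V_n$, $V_0=\{v_0\}$, $1\le|V_n|<\infty$, edges $E=\bigsqcup_{n\ge0}E_n$, $1\le|E_n|<\infty$, and range and source maps $r,s\colon E\to V$ with $r(E_n)=V_{n+1}$, $s(E_n)=V_n$. A path is a (finite or infinite) sequence of edges $(e_0,e_1,\ldots)$ with $r(e_{i-1})=s(e_i)$. $E_{n,N}$ is the set of finite paths from $V_n$ to $V_N$. $X_B$ is the set of infinite paths $(\alpha_0,\alpha_1,\ldots)$ ($\alpha_n\in E_n$) starting in $v_0$, with the topology generated by the cylinders $[e_0,\ldots,e_n]$ (all paths in $X_B$ beginning with $e_0,\ldots,e_n$). Telescoping $B$ along $0=n_0<n_1<\cdots$ gives the diagram with vertex sets $V_{n_k}$ and edge sets $E_{n_k,n_{k+1}}$. $B$ is simple if it can be telescoped to a diagram in which each vertex of each level is connected by an edge to each vertex of the next level. **Orders.** $B$ is ordered if $E$ carries a partial order in which $e,e'$ are comparable iff $r(e)=r(e')$. This extends to finite paths starting on the same level and ending in the same vertex, and to infinite paths which eventually agree,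 by comparing the edges on the last level where the paths differ. A path is maximal (minimal) if all its edges are. $B$ is properly ordered if $X_B$ has a unique maximal path $\gamma^+$ and a unique minimal path $\gamma^-$. The Vershik map $\phi_B\colon X_B\to X_B$ sends each non-maximal path to its successor and $\gamma^+$ to $\gamma^-$; it is a homeomorphism. $B$ and $\hat B$ are assumed to be simple, properly ordered, with path space a Cantor set. **Copy-pasting and extension triples.** Write $V_n=\{v_0(n),\ldots,v_{|V_n|-1}(n)\}$, let $r_\ell(n)$ be the number of $e\in E_n$ with range $v_\ell(n+1)$, and let $e_{\ell,0}(n)<e_{\ell,1}(n)<\cdots<e_{\ell,r_\ell(n)-1}(n)$ be these edges. $\hat B=(\hat V,\hat E,\hat\le)$ is obtained by copy-pasting $B$ if (possibly after relabelling) $\hat V_0=\{v_0\}$ and: (i) for $n\ge1$ there are $j_\ell(n)\in\mathbb N$ with $\hat V_n=\{v_\ell^j(n)\colon 0\le\ell<|V_n|,\ 0\le j<j_\ell(n)\}$; (ii) for $n\ge0$, $\hat E_n=\{e_{\ell,m}^j(n)\colon 0\le\ell<|V_{n+1}|,\ 0\le m<r_\ell(n),\ 0\le j<j_\ell(n+1)\}$ with $r(e_{\ell,m}^j(n))=v_\ell^j(n+1)$; (iii) for $n\ge1$, if $s(e_{\ell,m}(n))=v_{\ell'}(n)$ in $B$, then $s(e_{\ell,m}^j(n))=v_{\ell'}^{j'}(n)$ for some $j'$; (iv) $e_{\ell,m}^j(n)\,\hat<\,e_{\ell',m'}^{j'}(n')$ iff $j=j'$ and $e_{\ell,m}(n)<e_{\ell',m'}(n')$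 in $B$. The collapsing map $\pi\colon X_{\hat B}\to X_B$, $(e_{\ell_n,m_n}^{j_n}(n))_{n\ge0}\mapsto(e_{\ell_n,m_n}(n))_{n\ge0}$ is an (almost $1$-to-$1$) factor map, i.e. a continuous surjection with $\pi\circ\phi_{\hat B}=\phi_B\circ\pi$; $(B,\hat B,\pi)$ is called an extension triple. **Birkhoff spectrum.** Set $D=\{\alpha\in X_B\colon \exists\,\beta,\beta'\in\pi^{-1}\alpha\text{ with }\beta_0\ne\beta'_0\}$, where $\beta_0\in\hat E_0$ denotes the level-$0$ edge of $\beta\in X_{\hat B}$. For $\alpha\in X_B$, $n\in\mathbb N$ let $S_D^n(\alpha)=\frac1n\sum_{i=0}^{n-1}\mathbf 1_D(\phi_B^i\alpha)$ and $$S_D=\bigcup_{\alpha\in X_B}\ \bigcap_{N\in\mathbb N}\overline{\{S_D^n(\alpha)\colon n\ge N\}}.$$ An invariant measure of $(X_B,\phi_B)$ is a $\phi_B$-invariant Borel probability measure. *)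

(* Defs.v *)
From HB Require Import structures.
From mathcomp Require Import all_boot all_order all_algebra.
From mathcomp Require Import all_classical all_reals all_analysis.
Import Order.TTheory GRing.Theory Num.Theory.
Import numFieldNormedType.Exports.

Set Implicit Arguments.
Unset Strict Implicit.
Unset Printing Implicit Defensive.

Local Open Scope classical_set_scope.
Local Open Scope ring_scope.

(* [src n] and [rng n] are the restrictions to [E n] of the source and range
   maps.  Nonemptiness of every [V n] and [E n] follows from [card_V0] and the
   two surjectivity conditions. *)
Record bratteli := Bratteli {
  V : nat -> finType;
  E : nat -> finType;
  src : forall n, E n -> V n;
  rng : forall n, E n -> V n.+1;
  card_V0 : #|V 0| = 1%N;
  src_surj : forall n (v : V n), exists e : E n, src e = v;
  rng_surj : forall n (v : V n.+1), exists e : E n, rng e = v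
}.

Arguments src B {n} e : rename.
Arguments rng B {n} e : rename.

(* [joined v w]: some finite path leads from [v] to [w]. *)
Inductive joined (B : bratteli) (n : nat) (v : V B n) :
    forall N : nat, V B N -> Prop :=
| joined_refl : joined v v
| joined_rcons N (e : E B N) : joined v (src B e) -> joined v (rng B e).

(* An edge from [v] to [w] in the telescoped diagram is a path from [v] to [w]
   in the original one. *)
Definition simple_diagram (B : bratteli) : Prop :=
  exists k : nat -> nat,
    [/\ k 0%N = 0%N,
        forall i, (k i < k i.+1)%N &
        forall i (v : V B (k i)) (w : V B (k i.+1)), joined v w].

(* Paths start in the unique vertex of [V B 0] automatically. *)
Definition is_path (B : bratteli) (a : forall n, E B n) : Prop :=
  forall n, rng B (a n) = src B (a n.+1).

Definition path_space (B : bratteli) : Type :=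
  {a : forall n, E B n | is_path a}.

Definition level (B : bratteli) (a : path_space B) (n : nat) : E B n :=
  sval a n.

Coercion level : path_space >-> Funclass.

Lemma path_space_inhabited (B : bratteli) : inhabited (path_space B).
Proof.
have /fintype1[v0 _] := card_V0 B.
pose a := nat_rect (fun n => E B n) (projT1 (cid (src_surj v0)))
  (fun n e => projT1 (cid (src_surj (rng B e)))).
have aP : is_path a by move=> n /=; case: (cid _) => e /= ->.
by constructor; exists a.
Qed.

HB.instance Definition _ (B : bratteli) := gen_eqMixin (path_space B).
HB.instance Definition _ (B : bratteli) := gen_choiceMixin (path_space B).
HB.instance Definition _ (B : bratteli) :=
  isPointed.Build (path_space B) (inhabited_witness (path_space_inhabited B)).

(* The cylinder [a_0, ..., a_n]; every finite path from [V B 0] extends to an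
   infinite one, so all cylinders are of this form. *)
Definition cylinder (B : bratteli) (i : path_space B * nat) :
    set (path_space B) :=
  [set b | forall m, (m <= i.2)%N -> b m = i.1 m].

Lemma cylinder_cover (B : bratteli) :
  \bigcup_(i in setT) @cylinder B i = setT.
Proof. by apply/seteqP; split=> // a _; exists (a, 0%N). Qed.

Lemma cylinder_join (B : bratteli) (i j : path_space B * nat)
    (t : path_space B) :
  setT i -> setT j -> cylinder i t -> cylinder j t ->
  exists k, [/\ setT k, cylinder k t & cylinder k `<=` cylinder i `&` cylinder j].
Proof.
move=> _ _ it jt; exists (t, maxn i.2 j.2); split=> // b /= bt.
by split=> m mn; rewrite bt ?leq_max ?mn ?orbT//; [exact: it|exact: jt].
Qed.

HB.instance Definition _ (B : bratteli) :=
  isBaseTopological.Build (path_space B) (@cylinder_cover B) (@cylinder_join B).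

Definition is_cantor_set (T : topologicalType) : Prop :=
  exists (f : T -> cantor_space) (g : cantor_space -> T),
    [/\ cancel f g, cancel g f, continuous f & continuous g].

(* Only edges with the same range are comparable, and these lie on the same
   level, so the order on all of E is given by one relation on each level. *)
Record ordered_bratteli := OrderedBratteli {
  diagram :> bratteli;
  le_edge : forall n, rel (E diagram n);
  le_edge_refl : forall n, reflexive (@le_edge n);
  le_edge_anti : forall n, antisymmetric (@le_edge n);
  le_edge_trans : forall n, transitive (@le_edge n);
  le_edge_comparable : forall n (e e' : E diagram n),
    le_edge e e' || le_edge e' e = (rng diagram e == rng diagram e')
}.

Arguments le_edge B {n} e e' : rename.

Section OrderedDiagram.
Variable B : ordered_bratteli.
Implicit Types a b c : path_space B.

Definition lt_edge n (e e' : E B n) : bool := (e != e') && le_edge B e e'.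

Definition max_edge n (e : E B n) : Prop := forall e' : E B n, ~~ lt_edge e e'.
Definition min_edge n (e : E B n) : Prop := forall e' : E B n, ~~ lt_edge e' e.

Definition max_path a : Prop := forall n, max_edge (a n).
Definition min_path a : Prop := forall n, min_edge (a n).

Definition properly_ordered : Prop :=
  (exists! a, max_path a) /\ (exists! a, min_path a).

Definition lt_path a b : Prop :=
  exists2 n, lt_edge (a n) (b n) & forall m, (n < m)%N -> a m = b m.

Definition successor a b : Prop :=
  lt_path a b /\ ~ exists c, lt_path a c /\ lt_path c b.

(* The default value [a] of [xget] is never used if [B] is properly ordered. *)
Definition vershik a : path_space B :=
  xget a [set b | max_path a /\ min_path b \/ ~ max_path a /\ successor a b].

Definition standing : Prop :=
  [/\ simple_diagram B, properly_ordered & is_cantor_set (path_space B)].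

End OrderedDiagram.

(* [vlabel] sends the vertex v_l^j(n) to (v_l(n), j) and [elabel] sends the edge
   e_(l,m)^j(n) to (e_(l,m)(n), j); they witness the relabelling.  An edge
   e_(l,m)(n) of B is determined by its range v_l(n+1) and its rank m, so that
   the edges of B themselves serve as the indices (l, m).
   [copies v] is j_l(n) for v = v_l(n). *)
Record copy_pasting (B Bh : ordered_bratteli) := CopyPasting {
  copies : forall n, V B n.+1 -> nat;
  vlabel : forall n, V Bh n.+1 -> V B n.+1 * nat;
  elabel : forall n, E Bh n -> E B n * nat;
  copies_gt0 : forall n (v : V B n.+1), (0 < copies v)%N;
  vlabel_inj : forall n, injective (@vlabel n);
  vlabel_range : forall n (v : V B n.+1) j,
    (exists vh : V Bh n.+1, vlabel vh = (v, j)) <-> (j < copies v)%N;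
  elabel_inj : forall n, injective (@elabel n);
  elabel_range : forall n (e : E B n) j,
    (exists eh : E Bh n, elabel eh = (e, j)) <-> (j < copies (rng B e))%N;
  elabel_rng : forall n (eh : E Bh n),
    vlabel (rng Bh eh) = (rng B (elabel eh).1, (elabel eh).2);
  elabel_src : forall n (eh : E Bh n.+1),
    (vlabel (src Bh eh)).1 = src B (elabel eh).1;
  elabel_lt : forall n (eh eh' : E Bh n),
    lt_edge eh eh' <->
    (elabel eh).2 = (elabel eh').2 /\ lt_edge (elabel eh).1 (elabel eh').1
}.

Arguments elabel {B Bh} c {n} eh.
Arguments vlabel {B Bh} c {n} vh.

Lemma collapse_subproof (B Bh : ordered_bratteli) (c : copy_pasting B Bh)
    (b : path_space Bh) :
  is_path (fun n => (elabel c (b n)).1).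
Proof.
move=> n; rewrite -elabel_src -[b n.+1]/(sval b n.+1) -(svalP b n).
by rewrite elabel_rng.
Qed.

Definition collapse (B Bh : ordered_bratteli) (c : copy_pasting B Bh)
    (b : path_space Bh) : path_space B :=
  exist _ _ (collapse_subproof c b).

(* The map of the triple is [collapse T]. *)
Record extension_triple (B Bh : ordered_bratteli) := ExtensionTriple {
  triple_copy :> copy_pasting B Bh;
  triple_base : standing B;
  triple_ext : standing Bh
}.

Section BirkhoffSpectrum.
Variables (R : realType) (B Bh : ordered_bratteli) (T : extension_triple B Bh).

Definition discrepancy : set (path_space B) :=
  [set a | exists b b' : path_space Bh,
     [/\ collapse T b = a, collapse T b' = a & b 0%N <> b' 0%N]].

Definition birkhoff_average (n : nat) (a : path_space B) : R :=
  n%:R^-1 * \sum_(i < n) \1_discrepancy (iter i (@vershik B) a).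

Definition birkhoff_spectrum : set R :=
  \bigcup_(a in setT) \bigcap_(N in [set N | (0 < N)%N])
    closure [set birkhoff_average n a | n in [set n | (N <= n)%N]].

End BirkhoffSpectrum.

Definition borel (B : bratteli) := g_sigma_algebraType (@open (path_space B)).

Definition invariant_measure (R : realType) (B : ordered_bratteli)
    (mu : probability (borel B) R) : Prop :=
  forall A : set (borel B), measurable A ->
    mu (@vershik B @^-1` A) = mu A.

Arguments birkhoff_spectrum R {B Bh} T.

(* Main.v *)
Require Import Defs.
From HB Require Import structures.
From mathcomp Require Import all_boot all_order all_algebra.
From mathcomp Require Import all_classical all_reals all_analysis.
From mathcomp Require Import measurable_realfun zify ring lra.
Import Order.TTheory GRing.Theory Num.Theory.
Import numFieldNormedType.Exports.

(** Write phi for both Vershik maps, D for the discrepancy set and pi for the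
  collapsing map.  If the orbit of a path meets D, then its fibre consists of
  exactly two paths b, b', because phi is bijective and commutes with pi; the
  times at which the orbit is in D are then the times at which the orbit of
  (b, b') under phi x phi is in the set K of pairs with different edges at
  level 0.  This is where fibres with at most two points enter: over a larger
  fibre D would record the visits of several pairs at once.  So all averages can
  be computed on the compact space Y of pairs with equal images, where K is
  clopen, whereas D is only closed and its averages are not continuous.

  Let s be a cluster value of the averages of some path.  An ultrafilter limit
  of the empirical frequencies is an invariant finitely additive mean; by
  compactness it is countably additive on clopen sets, hence extends to an
  invariant Borel probability [clopen_extension], and its value on the compact
  set D is at least s, since it is an infimum over clopen covers of D.

  Conversely let t be positive and at most the supremum.  Integrating visit
  counts [invariant_measure_le] gives, for each n, a pair in Y whose average at
  time n is at least t, and then a pair all of whose averages are at least t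
  [dense_orbit_exists].  Among the closed invariant subsets of Y that contain
  such a pair, let Z be a minimal one.  By minimality the orbit of such a pair
  is dense in Z, so every open subset of Z has points with long averages of
  about t or more.  It also has points with long averages of about t or less
  [low_average_in].  The reason is that both components of a pair pass through
  the bottoms of high towers at the same times, where both are close to the
  unique minimal path: every orbit in Y has arbitrarily long gaps between visits
  to K [fibre_gaps].  An orbit of average at least t that enters such a gap can
  be cut so that a stretch of average at least t remains; if all long averages
  from some open set were above t, this stretch would avoid the open set, and a
  limit of such stretches would live in a smaller closed invariant set.
  Nesting clopen sets then yields a pair whose averages oscillate around t, and
  as they move by at most 1/n at time n, the number t is a cluster value
  [density_cluster_exists].  The value 0 comes from the minimal path: all
  paths over it are minimal, so there is at most one, and its orbit avoids D. *)

Local Open Scope classical_set_scope.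
Local Open Scope ring_scope.

(** * Averages of visits to a clopen set *)

Section VisitCounts.
Set Implicit Arguments.
Unset Strict Implicit.

(** Compactness for directed rather than decreasing families, as chains in the
  sense of Zorn's lemma need not be sequences. *)
Lemma compact_directed (X : topologicalType) (A : set X) (I : Type)
    (D : set I) (F : I -> set X) :
  compact A -> D !=set0 ->
  (forall i j, D i -> D j -> exists2 k, D k & F k `<=` F i `&` F j) ->
  (forall i, D i -> closed (F i)) -> (forall i, D i -> A `&` F i !=set0) ->
  exists2 x, A x & forall i, D i -> F i x.
Proof.
move=> cA [i0 Di0] dirF clF meetF.
pose G := filter_from D (fun i => A `&` F i).
have FG : ProperFilter G.
  apply: filter_from_proper => //; apply: filter_from_filter; first by exists i0.
  move=> i j Di Dj; have [k Dk kij] := dirF i j Di Dj.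
  by exists k => // x [Ax /kij[]].
have [|x [Ax clx]] := cA G FG; first by exists i0 => // x [].
exists x => // i Di; apply: (clF i Di) => U Ux.
have [|y [[_ Fy] Uy]] := clx (A `&` F i) U _ Ux; first by exists i.
by exists y.
Qed.

Lemma compact_nested (X : topologicalType) (A : set X) (F : nat -> set X) :
  compact A -> (forall n, closed (F n)) -> (forall n, F n.+1 `<=` F n) ->
  (forall n, A `&` F n !=set0) -> exists2 x, A x & forall n, F n x.
Proof.
move=> cA clF decF meetF.
have decr m n : (m <= n)%N -> F n `<=` F m.
  elim: n => [|n IH]; first by rewrite leqn0 => /eqP ->.
  by rewrite leq_eqVlt => /orP[/eqP -> //|/IH mn x /decF /mn].
have dirF i j : setT i -> setT j -> exists2 k, setT k & F k `<=` F i `&` F j.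
  move=> _ _; exists (maxn i j) => // x Fx.
  by split; apply: decr Fx; rewrite ?leq_maxl ?leq_maxr.
have nT : [set: nat] !=set0 by exists 0%N.
have [//|//|x Ax Fx] := compact_directed cA nT dirF.
by exists x => // n; exact: Fx.
Qed.

Variables (R : realType) (W : topologicalType) (T : W -> W) (K : set W).
Implicit Types (y z : W) (t e : R).

Definition visits (n : nat) (y : W) : nat := \sum_(i < n) (iter i T y \in K).

Lemma visits0 y : visits 0 y = 0%N.
Proof. by rewrite /visits big_ord0. Qed.

Lemma visitsS n y : visits n.+1 y = (visits n y + (iter n T y \in K))%N.
Proof. by rewrite /visits big_ord_recr. Qed.

Lemma visitsD m n y : visits (m + n) y = (visits m y + visits n (iter m T y))%N.
Proof.
elim: n => [|n IH]; first by rewrite addn0 visits0 addn0.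
by rewrite addnS !visitsS IH addnA -iterD addnC [(n + m)%N]addnC addnC.
Qed.

Lemma visits_le n y : (visits n y <= n)%N.
Proof.
by elim: n => [|n IH]; rewrite ?visits0// visitsS -addn1 leq_add// leq_b1.
Qed.

Lemma visits_gap n y : (forall i, (i < n)%N -> ~ K (iter i T y)) ->
  visits n y = 0%N.
Proof.
move=> gap; rewrite /visits big1// => i _.
by apply/eqP; rewrite eqb0; apply/negP => /set_mem; exact: gap.
Qed.

(** Dense in the sense of density: the visits have density at least t from the
  very first step on, which unlike a bound on the limit is a closed condition. *)
Definition dense_orbit t y := forall n, t * n%:R <= (visits n y)%:R.

Definition density_cluster t y := forall e, 0 < e -> forall N : nat,
  exists2 n, (N <= n)%N & `|n%:R^-1 * (visits n y)%:R - t| < e.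

(** The averages are compared with t through this cocycle, which is additive
  along orbits, while averages are not. *)
Definition excess t y n : R := (visits n y)%:R - t * n%:R.

Lemma excessD t y m n :
  excess t y (m + n) = excess t y m + excess t (iter m T y) n.
Proof. by rewrite /excess visitsD !natrD; ring. Qed.

Lemma excessS_le t y n : 0 <= t -> excess t y n.+1 <= excess t y n + 1.
Proof.
move=> t0; rewrite /excess visitsS natrD -addn1 natrD.
have : ((iter n T y \in K)%:R : R) <= 1 by case: (_ \in _).
by lra.
Qed.

Lemma excessS_ge t y n : t <= 1 -> excess t y n - 1 <= excess t y n.+1.
Proof.
move=> t0; rewrite /excess visitsS natrD -addn1 natrD.
have : 0 <= ((iter n T y \in K)%:R : R) by [].
by lra.
Qed.

Lemma excess_gap t y n : (forall i, (i < n)%N -> ~ K (iter i T y)) ->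
  excess t y n = - (t * n%:R).
Proof. by move=> gap; rewrite /excess visits_gap// sub0r. Qed.

(** The averages move by at most 1/n at time n, so for large n they cannot jump
  over a small neighbourhood of t. *)
Lemma oscillation_cluster t y : 0 <= t <= 1 ->
  (forall k : nat, exists2 n, (k <= n)%N & excess t y n < k.+1%:R^-1 * n%:R) ->
  (forall k : nat, exists2 n, (k <= n)%N & - (k.+1%:R^-1 * n%:R) < excess t y n) ->
  density_cluster t y.
Proof.
move=> /andP[t0 t1] low high e e0 N.
(* From time k on, a single step changes the average by less than e. *)
pose k := maxn N (Num.truncn e^-1).+1.
have ek : 1 < e * k%:R.
  have : e^-1 < k%:R.
    apply: lt_le_trans (truncnS_gt _) _.
    by rewrite ler_nat leq_maxr.
  by rewrite -(ltr_pM2l e0 e^-1) divff// gt_eqF.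
have k0 : (0 < k)%N by rewrite leq_max orbT.
have ke : k.+1%:R^-1 < e.
  rewrite -(ltr_pM2r (ltr0Sn R k)) mulVf ?pnatr_eq0//.
  by apply: lt_trans ek _; rewrite ltr_pM2l// ltr_nat.
suff [n kn /andP[n1 n2]] : exists2 n, (k <= n)%N &
    - (e * n%:R) < excess t y n < e * n%:R.
  exists n; first by apply: leq_trans kn; rewrite leq_maxl.
  have n0 : 0 < n%:R :> R by rewrite ltr0n (leq_trans k0).
  have -> : n%:R^-1 * (visits n y)%:R - t = n%:R^-1 * excess t y n.
    by rewrite /excess; field; rewrite gt_eqF.
  rewrite normrM gtr0_norm ?invr_gt0// mulrC ltr_pdivrMr//.
  by rewrite ltr_norml n1 n2.
have wk m : (k <= m)%N -> k.+1%:R^-1 * m%:R < e * m%:R.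
  by move=> km; rewrite ltr_pM2r// ltr0n (leq_trans k0).
have [M kM lowM] := low k; have [M' kM' highM'] := high k.
have {}lowM : excess t y M < e * M%:R by apply: lt_trans (wk _ kM).
have {}highM' : - (e * M'%:R) < excess t y M'.
  by apply: le_lt_trans highM'; rewrite lerN2 ltW// wk.
have ltk m : (k <= m)%N -> 1 < e * m%:R.
  by move=> km; apply: lt_le_trans ek _; rewrite ler_pM2l// ler_nat.
have [MM'|M'M] := leqP M M'.
- pose P n := (M <= n)%N && (- (e * n%:R) < excess t y n).
  have exP : exists n, P n by exists M'; rewrite /P MM'.
  case: (ex_minnP exP) => n /andP[Mn nlow] minn.
  exists n; first exact: leq_trans Mn.
  rewrite nlow /=; move: Mn; rewrite leq_eqVlt => /orP[/eqP <- //|].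
  case: n nlow minn => // n nlow minn; rewrite ltnS => Mn.
  have : ~~ P n by apply/negP => /minn; rewrite ltnn.
  rewrite /P Mn /= -leNgt => nn.
  have := excessS_le y n t0; have := ltk n (leq_trans kM Mn).
  by rewrite -addn1 natrD mulrDr mulr1; lra.
- pose P n := (M' <= n)%N && (excess t y n < e * n%:R).
  have exP : exists n, P n by exists M; rewrite /P ltnW.
  case: (ex_minnP exP) => n /andP[Mn nlow] minn.
  exists n; first exact: leq_trans Mn.
  rewrite nlow andbT; move: Mn; rewrite leq_eqVlt => /orP[/eqP <- //|].
  case: n nlow minn => // n nlow minn; rewrite ltnS => Mn.
  have : ~~ P n by apply/negP => /minn; rewrite ltnn.
  rewrite /P Mn /= -leNgt => nn.
  have := excessS_ge y n t1; have := ltk n (leq_trans kM' Mn).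
  by rewrite -addn1 natrD mulrDr mulr1; lra.
Qed.

Hypothesis cT : continuous T.
Hypothesis oK : open K.
Hypothesis clK : closed K.

Lemma continuous_iter n : continuous (iter n T).
Proof.
elim: n => [|n IH] y /=; first exact: cvg_id.
by apply: continuous_comp; [exact: IH|exact: cT].
Qed.

(** For a K that is merely closed, such as the discrepancy set, counts can drop
  under small perturbations. *)
Lemma near_visits n y : \forall z \near y, visits n z = visits n y.
Proof.
elim: n => [|n IH]; first by near=> z; rewrite !visits0.
have nearK : \forall z \near y, (iter n T z \in K) = (iter n T y \in K).
  have [Ky|nKy] := pselect (K (iter n T y)).
  - have : \forall z \near y, K (iter n T z).
      by apply: (@continuous_iter n y); exact: open_nbhs_nbhs.
    by apply: filterS => z Kz; rewrite !mem_set.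
  - have : \forall z \near y, (~` K) (iter n T z).
      apply: (@continuous_iter n y); apply: open_nbhs_nbhs; split=> //.
      exact: closed_openC.
    by apply: filterS => z Kz; rewrite !memNset.
by near=> z; rewrite !visitsS (near IH z)// (near nearK z).
Unshelve. all: by end_near. Qed.

Lemma open_visits n (P : nat -> Prop) : open [set y | P (visits n y)].
Proof.
rewrite openE => y /= Py; apply: filterS (near_visits n y) => z /= ->; exact: Py.
Qed.

Lemma closed_visits n (P : nat -> Prop) : closed [set y | P (visits n y)].
Proof. by rewrite -openC; exact: (@open_visits n (fun k => ~ P k)). Qed.

Variable Y : set W.
Hypothesis cY : compact Y.

(** Compactness turns long stretches of an orbit along which every average
  from the start is nearly t into an orbit all of whose averages are t. *)
Lemma dense_orbit_compact t (F : nat -> set W) :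
  (forall n, closed (F n)) -> (forall n, F n.+1 `<=` F n) ->
  (forall L : nat, exists y, [/\ Y y, F L y & forall n, (n <= L)%N ->
     (t - L.+1%:R^-1) * n%:R <= (visits n y)%:R]) ->
  exists z, [/\ Y z, forall n, F n z & dense_orbit t z].
Proof.
move=> clF decF ex.
pose G L := F L `&` \bigcap_(n in [set n | (n <= L)%N])
  [set y | (t - L.+1%:R^-1) * n%:R <= (visits n y)%:R].
have [|L|L|z Yz Gz] := @compact_nested W Y G cY.
- move=> L; apply: closedI => //; apply: closed_bigI => n _.
  exact: (@closed_visits n (fun k => (t - L.+1%:R^-1) * n%:R <= k%:R)).
- move=> y [/decF Fy Gy]; split=> // n nL.
  apply: le_trans (Gy n (leqW nL)); rewrite ler_wpM2r// lerB//.
  by rewrite lef_pV2 ?posrE// ler_nat.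
- by have [y [Yy Fy Gy]] := ex L; exists y; split.
exists z; split=> // [n|n]; first by have [] := Gz n.
suff small e : 0 < e -> t * n%:R <= (visits n z)%:R + e.
  by apply/ler_addgt0Pr; exact: small.
move=> e0.
have [L [nL Le]] : exists L, (n <= L)%N /\ n%:R * L.+1%:R^-1 <= e.
  exists (maxn n (Num.truncn (n%:R / e))); split; first exact: leq_maxl.
  rewrite ler_pdivrMr// mulrC -ler_pdivrMr//.
  apply: ltW; apply: lt_le_trans (truncnS_gt _) _.
  by rewrite ler_nat ltnS leq_maxr.
have [_ /(_ n nL) /=] := Gz L.
by rewrite mulrBl lerBlDr => H; apply: le_trans H _; rewrite lerD2l mulrC.
Qed.

Hypothesis TY : forall y, Y y -> Y (T y).

Lemma iterY n y : Y y -> Y (iter n T y).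
Proof. by move=> Yy; elim: n => //= n; exact: TY. Qed.

(** From the place where the excess over [t - e] is least, all averages are at
  least [t - e].  In a long stretch of average t the excess over [t - e] is large
  towards the end, so that this place leaves room for L further steps. *)
Lemma dense_orbit_exists t : 0 <= t ->
  (forall n, exists2 y, Y y & t * n%:R <= (visits n y)%:R) ->
  exists2 z, Y z & dense_orbit t z.
Proof.
move=> t0 ex; have clT (n : nat) : closed [set: W] by exact: closedT.
have [//|L|z [Yz _ gz]] := @dense_orbit_compact t (fun=> setT) clT.
  set e : R := L.+1%:R^-1; have e0 : 0 < e by rewrite invr_gt0.
  (* With this M the excess over [t - e] grows by at least 2 L + 2 up to time M,
     more than it can grow during the last L steps. *)
  pose M := (L.+1 * (L.+1 * 2))%N; have [y Yy hy] := ex M.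
  have [q _ minq] : exists2 q : 'I_M.+1, true &
      forall i : 'I_M.+1, excess (t - e) y q <= excess (t - e) y i.
    have [//|q _ minq] := @arg_minP _ _ _ ord0 xpredT
      (fun q : 'I_M.+1 => excess (t - e) y q).
    by exists q => // i; exact: minq.
  have qL : (q + L <= M)%N.
    rewrite leqNgt; apply/negP => Mq.
    have exq : excess (t - e) y q <= 0.
      by apply: le_trans (minq ord0) _; rewrite /excess visits0 mulr0 subr0.
    pose i := (M - q)%N; have Mi : M = (q + i)%N by rewrite /i subnKC// -ltnS.
    have iL : (i < L)%N by rewrite /i; lia.
    have : e * M%:R <= excess (t - e) y M by rewrite /excess mulrBl; lra.
    rewrite [M in excess _ _ M]Mi excessD.
    have -> : e * M%:R = 2 * L.+1%:R.
      by rewrite /e /M !natrM; field; rewrite addrC natr1 pnatr_eq0.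
    have iL1 : i%:R + 1 <= L.+1%:R :> R by rewrite natr1 ler_nat ltnW// ltnS.
    have vi : (visits i (iter q T y))%:R <= i%:R :> R.
      by rewrite ler_nat visits_le.
    have e1 : e <= 1 by rewrite invf_le1// ler1n.
    have : 0 <= t * i%:R by rewrite mulr_ge0.
    have : 0 <= (1 - e) * i%:R by rewrite mulr_ge0// subr_ge0.
    by rewrite [excess _ (iter _ _ _) _]/excess; lra.
  exists (iter q T y); split=> // [|n nL]; first exact: iterY.
  have qn : (q + n < M.+1)%N by lia.
  by have := minq (Ordinal qn); rewrite /= excessD /excess; lra.
by exists z.
Qed.

(** The minimal closed invariant set is the complement of V in Y.  A C which the
  orbit of z avoids could be added to V together with its preimages, so that
  maximality of V forces this orbit to be dense in the minimal set. *)
Lemma minimal_dense_set t : (exists2 z, Y z & dense_orbit t z) ->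
  exists V : set W,
  [/\ open V, forall y, V (T y) -> V y,
      exists z, [/\ Y z, ~ V z & dense_orbit t z] &
      forall C, open C -> (exists y, [/\ Y y, ~ V y & C y]) ->
      forall z, Y z -> ~ V z -> dense_orbit t z -> exists i, C (iter i T z)].
Proof.
move=> [z0 Yz0 dz0].
pose P V := [/\ open V, forall y, V (T y) -> V y &
  exists z, [/\ Y z, ~ V z & dense_orbit t z]].
have [F FP totF|V [[oV invV exV] maxV]] := @Zorn_bigcup W P.
  split.
  - by apply: bigcup_open => V /FP[].
  - by move=> y [V FV VTy]; exists V => //; have [_ inv _] := FP _ FV; exact: inv.
  have [F0|nF0] := pselect (F !=set0); last first.
    by exists z0; split=> // -[V FV _]; apply: nF0; exists V.
  (* A chain has an upper bound because the points with all averages at least t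
     form a closed set, so that compactness applies. *)
  pose Gd V := ~` V `&` \bigcap_n [set y | t * n%:R <= (visits n y)%:R].
  have [U V FU FV|V FV|V FV|z Yz Gz] := @compact_directed _ Y _ F Gd cY F0.
  - have [UV|VU] := totF _ _ FU FV.
    + by exists V => // y [Vy dy]; split; split=> //; exact: subsetC UV _ Vy.
    + by exists U => // y [Vy dy]; split; split=> //; exact: subsetC VU _ Vy.
  - apply: closedI; first by apply: open_closedC; have [] := FP _ FV.
    apply: closed_bigI => n _.
    exact: (@closed_visits n (fun k => t * n%:R <= k%:R)).
  - have [_ _ [z [Yz nVz dz]]] := FP _ FV.
    by exists z; split=> //; split=> // n _; exact: dz.
  exists z; split=> //; first by move=> [V FV]; have [] := Gz _ FV.
  by have [V FV] := F0; have [_ dz] := Gz _ FV; move=> n; exact: dz.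
exists V; split=> // C oC [y [Yy nVy Cy]] z Yz nVz dz.
apply: contrapT => nC.
apply: (maxV (V `|` \bigcup_i (iter i T @^-1` C))).
  split; first by apply: subsetUl.
  by move=> /(_ y) Vy; apply: nVy; apply: Vy; right; exists 0%N.
split.
- apply: openU => //; apply: bigcup_open => i _.
  by apply: open_comp => // x _; exact: continuous_iter.
- move=> x [/invV|[i _ Cx]]; [by left|right].
  by exists i.+1 => //; rewrite /preimage /mkset iterSr.
- by exists z; split=> // -[//|[i _ Cz]]; apply: nC; exists i.
Qed.

Hypothesis gaps : forall y, Y y -> forall n : nat,
  exists r, forall i, (i < n)%N -> ~ K (iter (r + i) T y).

(** Otherwise long averages from points of C outside V are at least [t + e].
  Take a gap of length N starting at r, and let q be the last time up to r at which the
  excess is at most its value c at the end of the gap.  From q on the averages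
  are at least t until the end of the gap, as the excess stays above c.  A visit
  to C in between would raise the excess above c at the end of the gap, so the
  orbit avoids C for a long time after q.  A limit of such points is a point
  with all averages at least t whose orbit avoids C, against minimality. *)
Lemma low_average_in (t e : R) (V C : set W) (n : nat) : 0 <= t -> 0 < e ->
  open V -> (forall y, V (T y) -> V y) ->
  (exists z, [/\ Y z, ~ V z & dense_orbit t z]) ->
  (forall z, Y z -> ~ V z -> dense_orbit t z -> exists i, C (iter i T z)) ->
  open C ->
  exists y, [/\ Y y, ~ V y, C y &
    exists2 m, (n <= m)%N & excess t y m < e * m%:R].
Proof.
move=> t0 e0 oV invV [z [Yz nVz dz]] hitC oC; apply: contrapT => noy.
have highC y m : Y y -> ~ V y -> C y -> (n <= m)%N -> e * m%:R <= excess t y m.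
  move=> Yy nVy Cy nm; rewrite leNgt; apply/negP => lt.
  by apply: noy; exists y; split=> //; exists m.
have Yi i : Y (iter i T z) by exact: iterY.
have nVi i : ~ V (iter i T z) by elim: i => //= i; exact: contra_not (invV _).
pose F L := ~` V `&` \bigcap_(i in [set i | (i <= L)%N]) (iter i T @^-1` (~` C)).
have [|L|L|z' [Yz' Fz' dz']] := @dense_orbit_compact t F.
- move=> L; apply: closedI; first exact: open_closedC.
  apply: closed_bigI => i _; apply: closed_comp; last exact: open_closedC.
  by move=> y _; exact: continuous_iter.
- by move=> y [nVy Fy]; split=> // i iL; apply: Fy; exact: leqW.
- (* The gap must outlast q + L by n steps, and a gain of e per step over the
     whole gap must exceed 1, the slack in the choice of q. *)
  pose N := (n + L + (Num.truncn e^-1).+1)%N.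
  have eN : 1 < e * N%:R.
    have : e^-1 < N%:R.
      by apply: lt_le_trans (truncnS_gt _) _; rewrite ler_nat leq_addl.
    by rewrite -(ltr_pM2l e0 e^-1) divff// gt_eqF.
  have [r rgap] := gaps Yz N.
  pose g := excess t z.
  have gr i : (i <= N)%N -> g (r + i)%N = g r - t * i%:R.
    move=> iN; rewrite /g excessD [excess _ (iter _ _ _) _]excess_gap// => j ji.
    by rewrite -iterD addnC; apply: rgap; exact: leq_trans iN.
  pose c := g (r + N)%N.
  have c0 : 0 <= c by rewrite /c /g /excess subr_ge0.
  have cr : c <= g r by rewrite /c gr// gerBl mulr_ge0.
  (* Time 0 qualifies, since the excess of z is never negative. *)
  have [q [qr gq maxq]] : exists q, [/\ (q <= r)%N, g q <= c &
      forall i, (q < i)%N -> (i <= r)%N -> c < g i].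
    pose Q i := (i <= r)%N && (g i <= c).
    have exQ : exists i, Q i.
      by exists 0%N; rewrite /Q /= /g /excess visits0 mulr0 subrr.
    have Qr i : Q i -> (i <= r)%N by case/andP.
    case: (ex_maxnP exQ Qr) => q /andP[qr gq] maxq; exists q; split=> // i qi ir.
    rewrite ltNge; apply/negP => gi; have := maxq i; rewrite /Q ir gi => /(_ isT).
    by rewrite leqNgt qi.
  have gq1 : c - 1 <= g q.
    move: qr; rewrite leq_eqVlt => /orP[/eqP ->|qr]; first by lra.
    have := maxq q.+1 (ltnSn q) qr; have := excessS_le z q t0; rewrite -/g.
    by lra.
  have gi i : (q < i)%N -> (i <= r + N)%N -> c <= g i.
    move=> qi irN; have [ir|/ltnW ri] := leqP i r; first by rewrite ltW// maxq.
    rewrite -(subnKC ri) /c !gr//; last by rewrite leq_subLR.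
    by rewrite lerD2l lerN2 ler_wpM2l// ler_nat leq_subLR.
  have noC i : (q <= i)%N -> (i <= q + L)%N -> ~ C (iter i T z).
    move=> qi iqL Ci.
    have irN : (i + n <= r + N)%N by rewrite /N; lia.
    have := highC _ (r + N - i)%N (Yi i) (nVi i) Ci; rewrite leq_subRL; last by lia.
    move=> /(_ irN).
    have -> : excess t (iter i T z) (r + N - i) = c - g i.
      rewrite /c /g; have := excessD t z i (r + N - i); rewrite subnKC; last by lia.
      by move=> ->; rewrite addrC addKr.
    move: qi; rewrite leq_eqVlt => /orP[/eqP <-|qi].
      have : e * N%:R <= e * (r + N - q)%:R by rewrite ler_pM2l// ler_nat; lia.
      by lra.
    have : 0 < e * (r + N - i)%:R by rewrite mulr_gt0// ltr0n; lia.
    by have : c <= g i; [apply: gi => //; lia | lra].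
  exists (iter q T z); split=> //.
    split; first exact: nVi.
    by move=> i /= iL; rewrite -iterD addnC; apply: noC; lia.
  move=> m mL; rewrite mulrBl.
  have : 0 <= excess t (iter q T z) m.
    case: m mL => [|m] mL; first by rewrite /excess visits0 mulr0 subrr.
    have := gi (q + m.+1)%N; rewrite /g excessD -/g.
    have -> : (q < q + m.+1)%N by lia.
    have -> : (q + m.+1 <= r + N)%N by rewrite /N; lia.
    by move=> /(_ isT isT); lra.
  by rewrite subr_ge0; apply: le_trans; rewrite gerBl mulr_ge0.
have [|i Ci] := hitC z' Yz' _ dz'; first by have [] := Fz' 0%N.
by have [_ /(_ i)] := Fz' i; rewrite /= leqnn => /(_ isT).
Qed.

(** In a minimal set both low and high averages occur in every open set, so a
  point with averages oscillating around t is found by nesting clopen sets. *)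
Lemma density_cluster_exists t : 0 <= t ->
  (exists2 z, Y z & dense_orbit t z) -> exists2 y, Y y & density_cluster t y.
Proof.
move=> t0 exz; have [V [oV invV exV minV]] := minimal_dense_set exz.
have [z [Yz nVz dz]] := exV.
have t1 : t <= 1.
  have := dz 1%N; rewrite mulr1 => /le_trans; apply.
  by rewrite lern1 visits_le.
pose meets C := exists y, [/\ Y y, ~ V y & C y].
pose low k y := exists2 n, (k <= n)%N & excess t y n < k.+1%:R^-1 * n%:R.
pose high k y := exists2 n, (k <= n)%N & - (k.+1%:R^-1 * n%:R) < excess t y n.
pose good (k : nat) (C C' : set W) := [/\ clopen C', meets C', C' `<=` C,
  forall y, C' y -> low k y & forall y, C' y -> high k y].
(* One step of the nesting: freeze a low average at y, then a high average at a
   point x of the orbit of z. *)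
have step (kC : nat * set W) :
    exists C', clopen kC.2 -> meets kC.2 -> good kC.1 kC.2 C'.
  case: kC => k C /=.
  have [[clC meC]|nC] := pselect (clopen C /\ meets C); last first.
    by exists C => clC meC; exfalso; apply: nC.
  have k0 : 0 < k.+1%:R^-1 :> R by rewrite invr_gt0.
  have [|y [Yy nVy Cy [n kn lown]]] :=
    @low_average_in t _ V C k t0 k0 oV invV exV _ clC.1.
    by move=> x Yx nVx dx; exact: minV clC.1 meC _ Yx nVx dx.
  pose C1 := C `&` [set x | visits n x = visits n y].
  have clC1 : clopen C1.
    by apply: clopenI => //; split;
      [exact: (@open_visits n (fun m => m = visits n y))
      |exact: (@closed_visits n (fun m => m = visits n y))].
  have [|i Ci] := minV C1 clC1.1 _ z Yz nVz dz; first by exists y.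
  pose x := iter i T z.
  have [m km im] : exists2 m, (k <= m)%N & i%:R < k.+1%:R^-1 * m%:R :> R.
    (* The excess of z up to time i is at most i; m is large enough to absorb it. *)
    exists (k + (i * k.+1).+1)%N; first exact: leq_addr.
    rewrite mulrC ltr_pdivlMr// -natrM ltr_nat; lia.
  exists (C1 `&` [set w | visits m w = visits m x]) => _ _; split.
  - by apply: clopenI => //; split;
      [exact: (@open_visits m (fun l => l = visits m x))
      |exact: (@closed_visits m (fun l => l = visits m x))].
  - exists x; split=> //; first exact: iterY.
    by rewrite /x; elim: (i) => //= j; exact: contra_not (invV _).
  - by move=> w [[]].
  - by move=> w [[_ /= ew] _]; exists n => //; rewrite /excess ew.
  - move=> w [_ /= ew]; exists m => //; rewrite /excess ew.
    rewrite -/(excess t x m); have := excessD t z i m; rewrite -/x => H.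
    have : 0 <= excess t z (i + m) by rewrite /excess subr_ge0.
    have : excess t z i <= i%:R.
      rewrite /excess lerBlDr (le_trans (_ : _ <= i%:R))// ?ler_nat ?visits_le//.
      by rewrite lerDl mulr_ge0.
    by rewrite H; move: im; move: (_^-1 * _) => u; lra.
have [f fP] := choice step.
pose C := nat_rect (fun=> set W) setT (fun k C => f (k, C)).
have clC k : clopen (C k) /\ meets (C k).
  elim: k => [|k [cl me]]; first by split; [exact: clopenT|exists z].
  by have [] := fP (k, C k) cl me.
have goodC k : good k (C k) (C k.+1).
  by have [cl me] := clC k; exact: fP (k, C k) cl me.
have [k|k|k|y Yy Cy] := @compact_nested _ Y C cY.
- by have [[]] := clC k.
- by have [] := goodC k.
- by have [_ [w [Yw _ Cw]]] := clC k; exists w.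
exists y => //; apply: oscillation_cluster; first by rewrite t0.
- by move=> k; have [_ _ _ lowk _] := goodC k; exact: lowk (Cy k.+1).
- by move=> k; have [_ _ _ _ highk] := goodC k; exact: highk (Cy k.+1).
Qed.

End VisitCounts.

(** * Paths and the Vershik map *)

Section Paths.
Set Implicit Arguments.
Unset Strict Implicit.
Variable B : bratteli.
Implicit Types a b c : path_space B.

Lemma path_ext a b : (forall n, a n = b n) -> a = b.
Proof.
by case: a b => [a aP] [b bP] ab; apply: eq_exist; apply: functional_extensionality_dep.
Qed.

Lemma pathP a n : rng B (a n) = src B (a n.+1).
Proof. exact: (svalP a n). Qed.

(** Extends a finite path, given as a sequence of edges which need not fit
  together later on; sources are onto, so a dead end can be left upwards. *)
Lemma follow_edges (a : forall n, E B n) : exists b, forall n,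
  (forall m, (m < n)%N -> rng B (a m) = src B (a m.+1)) -> b n = a n.
Proof.
pose b := nat_rect (fun n => E B n) (a 0%N) (fun n e =>
  if src B (a n.+1) == rng B e then a n.+1
  else projT1 (cid (src_surj (rng B e)))).
have bP : is_path b.
  by move=> n /=; case: eqP => [-> //|_]; case: (cid _) => e /= ->.
exists (exist _ b bP); elim=> [//|n IH] fit.
have bn : b n = a n by apply: IH => m /leqW; exact: fit.
by rewrite /level /= bn fit// eqxx.
Qed.

(** Every edge lies on a path because range maps are onto: go down to the root,
  then follow the edges found. *)
Lemma edge_on_path n (e : E B n) : exists a, a n = e.
Proof.
suff [a fit <-] : exists2 a : forall n, E B n,
    (forall m, (m < n)%N -> rng B (a m) = src B (a m.+1)) & a n = e.
  by have [b ab] := follow_edges a; exists b; exact: ab.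
elim: n e => [|n IH] e.
  have [a0] := path_space_inhabited B.
  by exists (@eqtype.dfwith nat (fun n => E B n) a0 0%N e) => //; rewrite dfwith_in.
have [e' e'P] := rng_surj (src B e); have [a fit an] := IH e'.
exists (@eqtype.dfwith nat (fun n => E B n) a n.+1 e); last by rewrite dfwith_in.
move=> m; rewrite ltnS leq_eqVlt => /orP[/eqP ->|mn].
  by rewrite dfwith_in dfwith_out ?gtn_eqF// an.
rewrite !dfwith_out ?fit ?gtn_eqF// ltnS ltnW//.
Qed.

Lemma splice a c n : rng B (a n) = rng B (c n) ->
  exists b, (forall m, (m <= n)%N -> b m = a m) /\
            (forall m, (n < m)%N -> b m = c m).
Proof.
move=> ac; pose b m := if (m <= n)%N then a m else c m.
have bP : is_path b.
  move=> m; rewrite /b; have [mn|nm|->] := ltngtP m n; last by rewrite ac pathP.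
  - exact: pathP.
  - exact: pathP.
exists (exist _ b bP); split=> m; rewrite /level /= /b; first by move->.
by rewrite ltnNge => /negbTE ->.
Qed.

(** Used with P minimality or maximality, this fills in the part of a path below
  a given level.  The edges are chosen from the top down. *)
Lemma replace_initial (P : forall n, E B n -> Prop) :
  (forall n (v : V B n.+1), exists2 e : E B n, rng B e = v & P n e) ->
  forall n c, exists b, (forall m, (n <= m)%N -> b m = c m) /\
                        (forall m, (m < n)%N -> P m (b m)).
Proof.
move=> exP; elim=> [|n IH] c; first by exists c.
have [e ev Pe] := exP n (rng B (c n)); have [a an] := edge_on_path e.
have [|d [dlow dhigh]] := @splice a c n; first by rewrite an.
have [b [bhigh blow]] := IH d; exists b; split=> m nm.
  by rewrite bhigh ?dhigh// ltnW.
move: nm; rewrite ltnS leq_eqVlt => /orP[/eqP ->|/blow //].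
by rewrite bhigh// dlow// an.
Qed.

End Paths.

Section EdgeOrder.
Set Implicit Arguments.
Unset Strict Implicit.

(** Applied to the edge order and to its converse. *)
Lemma finite_maximal (X : finType) (r : rel X) (P : X -> Prop) :
  irreflexive r -> transitive r -> (exists x, P x) ->
  exists2 x, P x & forall y, P y -> ~~ r x y.
Proof.
move=> irr tr [x0 Px0].
(* Induction on the number of elements above x0. *)
have [k] := ubnP #|[pred y | r x0 y]|.
elim: k => // k IH in x0 Px0 *; rewrite ltnS => lek.
have [[y Py xy]|nmax] := pselect (exists2 y, P y & r x0 y); last first.
  by exists x0 => // y Py; apply/negP => xy; apply: nmax; exists y.
apply: (IH y Py); apply: leq_trans lek; apply: proper_card; apply/properP; split.
  by apply/fintype.subsetP => z; rewrite !inE; exact: tr.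
by exists y; rewrite inE// irr.
Qed.

Variable B : ordered_bratteli.
Implicit Types a b c : path_space B.

Section Edges.
Variable n : nat.
Implicit Types e f g : E B n.

Lemma lt_edge_irr : irreflexive (@lt_edge B n).
Proof. by move=> e; rewrite /lt_edge eqxx. Qed.

Lemma lt_edge_trans : transitive (@lt_edge B n).
Proof.
move=> f e g /andP[nef ef] /andP[nfg fg]; apply/andP; split.
  apply: contra nef => /eqP eg; apply/eqP; apply: le_edge_anti.
  by rewrite ef eg.
exact: le_edge_trans ef fg.
Qed.

Lemma lt_edge_rng e f : lt_edge e f -> rng B e = rng B f.
Proof. by case/andP => _ ef; apply/eqP; rewrite -le_edge_comparable ef. Qed.

Lemma lt_edge_total e f : rng B e = rng B f -> e <> f -> lt_edge e f \/ lt_edge f e.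
Proof.
move=> /eqP; rewrite -le_edge_comparable /lt_edge [f == e]eq_sym => ef /eqP nef.
by rewrite nef /=; exact/orP.
Qed.

Definition next_edge e f := lt_edge e f /\ forall g, lt_edge e g -> ~~ lt_edge g f.

Lemma next_edge_exists e : ~ max_edge e -> exists f, next_edge e f.
Proof.
move=> /existsNP[f /negP/negPn ef].
have [|||g eg ming] := @finite_maximal _ (fun x y => @lt_edge B n y x) (@lt_edge B n e).
- exact: lt_edge_irr.
- by move=> y x z yx zy; exact: lt_edge_trans zy yx.
- by exists f.
by exists g; split.
Qed.

Lemma prev_edge_exists f : ~ min_edge f -> exists e, next_edge e f.
Proof.
move=> /existsNP[e /negP/negPn ef].
have [|||g gf maxg] := @finite_maximal _ (@lt_edge B n) (@lt_edge B n ^~ f).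
- exact: lt_edge_irr.
- exact: lt_edge_trans.
- by exists e.
exists g; split=> // h gh; apply/negP => hf; have := maxg h hf; by rewrite gh.
Qed.

Lemma max_edge_exists (v : V B n.+1) : exists2 e : E B n, rng B e = v & max_edge e.
Proof.
have [e ev] := rng_surj v.
have [|||g gv maxg] := @finite_maximal _ (@lt_edge B n) (fun e => rng B e = v).
- exact: lt_edge_irr.
- exact: lt_edge_trans.
- by exists e.
exists g => // h; apply/negP => gh; have := maxg h; rewrite gh.
by rewrite -(lt_edge_rng gh) => /(_ gv).
Qed.

Lemma min_edge_exists (v : V B n.+1) : exists2 e : E B n, rng B e = v & min_edge e.
Proof.
have [e ev] := rng_surj v.
have [|||g gv maxg] := @finite_maximal _ (fun x y => @lt_edge B n y x)
  (fun e => rng B e = v).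
- exact: lt_edge_irr.
- by move=> y x z yx zy; exact: lt_edge_trans zy yx.
- by exists e.
exists g => // h; apply/negP => gh; have := maxg h; rewrite gh.
by rewrite (lt_edge_rng gh) => /(_ gv).
Qed.

End Edges.

Lemma lt_path_tail a b : lt_path a b -> exists N, forall m, (N <= m)%N -> a m = b m.
Proof. by move=> [n _ ab]; exists n.+1. Qed.

Lemma lt_path_total a b N : (forall m, (N <= m)%N -> a m = b m) -> a <> b ->
  lt_path a b \/ lt_path b a.
Proof.
elim: N => [|N IH] ab nab; first by case: nab; apply: path_ext => n; exact: ab.
have [abN|abN] := pselect (a N = b N).
  by apply: IH => // m; rewrite leq_eqVlt => /orP[/eqP <- //|/ab].
have [|lt|lt] := @lt_edge_total N (a N) (b N) _ abN.
- by rewrite !pathP ab.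
- by left; exists N.
- by right; exists N => // m /ab.
Qed.

Lemma successor_unique a b c : successor a b -> successor a c -> b = c.
Proof.
move=> [ab abmin] [ac acmin]; apply: contrapT => nbc.
have [N abN] := lt_path_tail ab; have [M acM] := lt_path_tail ac.
have [m|bc|cb] := @lt_path_total b c (maxn N M) _ nbc.
- by rewrite geq_max => /andP[/abN <- /acM].
- by apply: acmin; exists b.
- by apply: abmin; exists c.
Qed.

Lemma predecessor_unique a b c : successor a c -> successor b c -> a = b.
Proof.
move=> [ab abmin] [ac acmin]; apply: contrapT => nbc.
have [N abN] := lt_path_tail ab; have [M acM] := lt_path_tail ac.
have [m|bc|cb] := @lt_path_total a b (maxn N M) _ nbc.
- by rewrite geq_max => /andP[/abN -> /acM].
- by apply: abmin; exists b.
- by apply: acmin; exists a.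
Qed.

(** The successor in odometer form, level n being the one that receives the
  carry. *)
Definition carries n a b := [/\ forall m, (m < n)%N -> max_edge (a m),
  next_edge (a n) (b n), forall m, (m < n)%N -> min_edge (b m) &
  forall m, (n < m)%N -> a m = b m].

(** A path strictly between a and b would agree with both above level n.  At
  level n it has the edge of a or of b, these being neighbours; below, it could
  not exceed a, which is maximal there, nor lie under b, which is minimal. *)
Lemma carries_successor n a b : carries n a b -> successor a b.
Proof.
move=> [maxa [ltn nextn] minb tail]; split; first by exists n.
move=> [c [[k ltk eqk] [l ltl eql]]].
have [kl|lk|kl] := ltngtP k l.
- have ltal : lt_edge (a l) (b l) by rewrite (eqk _ kl).
  have ln : l = n.
    have [ln|nl|//] := ltngtP l n.
      by have := minb l ln (a l); rewrite ltal.
    by move: ltal; rewrite tail// lt_edge_irr.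
  by move: ltk; apply/negP; apply: maxa; rewrite -ln.
- have ltak : lt_edge (a k) (b k) by rewrite -(eql _ lk).
  have kn : k = n.
    have [kn|nk|//] := ltngtP k n.
      by have := maxa k kn (b k); rewrite ltak.
    by move: ltak; rewrite tail// lt_edge_irr.
  by move: ltl; apply/negP; apply: minb; rewrite -kn.
- subst l; have ltak := lt_edge_trans ltk ltl.
  have kn : k = n.
    have [kn|nk|//] := ltngtP k n.
      by have := maxa k kn (b k); rewrite ltak.
    by move: ltak; rewrite tail// lt_edge_irr.
  by subst k; have := nextn _ ltk; rewrite ltl.
Qed.

Lemma carries_not_max n a b : carries n a b -> ~ max_path a.
Proof. by move=> [_ [lt _] _ _] /(_ n (b n)); rewrite lt. Qed.

Lemma first_failure (P : nat -> Prop) : ~ (forall n, P n) ->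
  exists2 n, ~ P n & forall m, (m < n)%N -> P m.
Proof.
move=> /existsNP[k nPk].
have ex : exists n, ~~ `[< P n >] by exists k; apply/asboolPn.
case: (ex_minnP ex) => n /asboolPn nPn minn; exists n => // m mn.
apply: contrapT => /asboolPn /minn; by rewrite leqNgt mn.
Qed.

Lemma carries_from a : ~ max_path a -> exists n b, carries n a b.
Proof.
move=> /first_failure[n nmax maxlt].
have [e [lte nexte]] := next_edge_exists nmax.
have [c cn] := edge_on_path e.
have [|d [dlow dhigh]] := @splice _ c a n; first by rewrite cn (lt_edge_rng lte).
have [b [bhigh blow]] := replace_initial (@min_edge_exists) n d.
exists n, b; split=> // [|m nm].
  by rewrite bhigh// dlow// cn.
by rewrite bhigh ?dhigh// ltnW.
Qed.

Lemma carries_to b : ~ min_path b -> exists n a, carries n a b.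
Proof.
move=> /first_failure[n nmin minlt].
have [e [lte nexte]] := prev_edge_exists nmin.
have [c cn] := edge_on_path e.
have [|d [dlow dhigh]] := @splice _ c b n; first by rewrite cn (lt_edge_rng lte).
have [a [ahigh alow]] := replace_initial (@max_edge_exists) n d.
exists n, a; split=> // [|m nm].
  by rewrite ahigh// dlow// cn.
by rewrite ahigh ?dhigh// ltnW.
Qed.

End EdgeOrder.

Section Vershik.
Set Implicit Arguments.
Unset Strict Implicit.
Variable B : ordered_bratteli.
Hypothesis properB : properly_ordered B.
Implicit Types a b c : path_space B.

Lemma max_path_unique a b : max_path a -> max_path b -> a = b.
Proof. by have [[c [_ uc]] _] := properB => /uc <- /uc <-. Qed.

Lemma min_path_unique a b : min_path a -> min_path b -> a = b.
Proof. by have [_ [c [_ uc]]] := properB => /uc <- /uc <-. Qed.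

Lemma vershikE a b :
  max_path a /\ min_path b \/ ~ max_path a /\ successor a b -> vershik a = b.
Proof.
move=> ab; rewrite /vershik; case: xgetP => [c _ ac|/(_ b)]; last by [].
case: ac ab => [[ma mc]|[nma sac]] [[ma' mb]|[nma' sab]] //.
- exact: min_path_unique.
- exact: successor_unique sac sab.
Qed.

Lemma vershik_max a b : max_path a -> min_path b -> vershik a = b.
Proof. by move=> ma mb; apply: vershikE; left. Qed.

Lemma vershik_carries n a b : carries n a b -> vershik a = b.
Proof.
move=> ab; apply: vershikE; right; split; first exact: carries_not_max ab.
exact: carries_successor ab.
Qed.

Lemma vershikP a : (max_path a /\ min_path (vershik a)) \/
  exists n, carries n a (vershik a).
Proof.
have [ma|/carries_from[n [b ab]]] := pselect (max_path a).
  by left; split=> //; have [_ [c [mc _]]] := properB; rewrite (vershik_max ma mc).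
by right; exists n; rewrite (vershik_carries ab).
Qed.

Lemma carries_not_min n a b : carries n a b -> ~ min_path b.
Proof. by move=> [_ [lt _] _ _] /(_ n (a n)); rewrite lt. Qed.

(** Successors and predecessors are unique, and the image of a path that is not
  maximal is not minimal. *)
Lemma vershik_inj : injective (@vershik B).
Proof.
move=> a b ab.
have [[ma mva]|[n ca]] := vershikP a; have [[mb mvb]|[m cb]] := vershikP b.
- exact: max_path_unique.
- by have := carries_not_min cb; rewrite -ab.
- by have := carries_not_min ca; rewrite ab.
- apply: (@predecessor_unique _ a b (vershik a)); first exact: carries_successor ca.
  by rewrite ab; exact: carries_successor cb.
Qed.

Lemma vershik_surj b : exists a, vershik a = b.
Proof.
have [mb|/carries_to[n [a ab]]] := pselect (min_path b).
  by have [[a [ma _]] _] := properB; exists a; exact: vershik_max.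
by exists a; exact: vershik_carries ab.
Qed.

Lemma iter_vershik_inj n : injective (iter n (@vershik B)).
Proof. by elim: n => //= n IH a b /vershik_inj /IH. Qed.

Lemma iter_vershik_surj n b : exists a, iter n (@vershik B) a = b.
Proof.
elim: n b => [|n IH] b; first by exists b.
by have [c <-] := vershik_surj b; have [a <-] := IH c; exists a.
Qed.

(** The orbit of a path climbs through the finite paths into its vertex at level
  N, in increasing order, and keeps the edges above meanwhile.  The outer
  induction is on N, the inner one on the number of edges above the edge at level N. *)
Lemma orbit_reaches_max N a : exists r,
  (forall m, (m < N)%N -> max_edge (iter r (@vershik B) a m)) /\
  (forall m, (N <= m)%N -> iter r (@vershik B) a m = a m).
Proof.
elim: N a => [|N IH] a; first by exists 0%N.
have [k] := ubnP #|[pred e | lt_edge (a N) e]|.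
elim: k => // k IHk in a *; rewrite ltnS => lek.
have [r [rmax rtail]] := IH a; set b := iter r _ a in rmax rtail.
have [maxN|nmaxN] := pselect (max_edge (a N)).
  exists r; split=> m; last by move=> /ltnW /rtail.
  by rewrite ltnS leq_eqVlt => /orP[/eqP ->|/rmax //]; rewrite -/b rtail.
have nmaxb : ~ max_edge (b N) by rewrite rtail.
have [[/(_ N) //]|[n cb]] := vershikP b.
have nN : n = N.
  have [nN|Nn|//] := ltngtP n N.
    by have [_ [lt _] _ _] := cb; have := rmax _ nN (vershik b n); rewrite lt.
  by have [/(_ N Nn)] := cb.
subst n; have [_ [ltb _] _ tailb] := cb.
have [|s [smax stail]] := IHk (vershik b).
  apply: leq_trans lek; apply: proper_card; apply/properP; split.
    by apply/fintype.subsetP => e; rewrite !inE -rtail//; exact: lt_edge_trans.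
  by exists (vershik b N); rewrite inE ?lt_edge_irr// -rtail.
exists (s + r.+1)%N; rewrite iterD -/b; split=> m mN; first exact: smax.
by rewrite stail// -tailb// rtail// ltnW.
Qed.

Lemma orbit_reaches_min N a : exists r,
  forall m, (m < N)%N -> min_edge (iter r (@vershik B) a m).
Proof.
have [r [rmax _]] := orbit_reaches_max N a; exists r.+1 => m mN /=.
have [[_ /(_ m)] //|[n [_ [lt _] min _]]] := vershikP (iter r (@vershik B) a).
apply: min; apply: leq_trans mN _; rewrite leqNgt; apply/negP => nN.
by have := rmax _ nN (vershik (iter r (@vershik B) a) n); rewrite lt.
Qed.

End Vershik.

(** * The topology of path spaces, and pairs in a common fibre *)

Section PathTopology.
Set Implicit Arguments.
Unset Strict Implicit.

Lemma nbhs_pathE (B : bratteli) (a : path_space B) (A : set (path_space B)) :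
  nbhs a A <-> exists n, forall b : path_space B,
    (forall m, (m <= n)%N -> b m = a m) -> A b.
Proof.
split=> [[U [[D _ <-] [i Di ai] UA]]|[n nA]].
  exists i.2 => b ba; apply: UA; exists i => // m mi.
  by rewrite ba// ai.
exists (@cylinder B (a, n)); split=> //.
by exists [set (a, n)] => //; rewrite bigcup_set1.
Qed.

Lemma path_continuous (B B' : bratteli) (f : path_space B -> path_space B') :
  (forall (a : path_space B) n, exists k, forall b : path_space B,
     (forall m, (m <= k)%N -> b m = a m) ->
     forall m, (m <= n)%N -> f b m = f a m) -> continuous f.
Proof.
move=> fP a A /nbhs_pathE[n nA]; apply/nbhs_pathE.
have [k kP] := fP a n; exists k => b ba; apply: nA; exact: kP.
Qed.

Lemma path_clopen (B : bratteli) n (A : set (path_space B)) :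
  (forall a b : path_space B, (forall m, (m <= n)%N -> b m = a m) -> A a -> A b) ->
  clopen A.
Proof.
move=> detA; split.
  by rewrite openE => a Aa; apply/nbhs_pathE; exists n => b /detA; apply.
rewrite -openC openE => a nAa; apply/nbhs_pathE; exists n => b ba Ab.
by apply: nAa; apply: detA Ab => m mn; rewrite ba.
Qed.

Lemma path_hausdorff (B : bratteli) : hausdorff_space (path_space B).
Proof.
move=> a b ab; apply: path_ext => n.
have [||c [/= ca cb]] := ab (@cylinder B (a, n)) (@cylinder B (b, n)).
- by apply/nbhs_pathE; exists n.
- by apply/nbhs_pathE; exists n.
by rewrite -(ca n)// -(cb n).
Qed.

Lemma cantor_set_compact (X : topologicalType) : is_cantor_set X -> compact [set: X].
Proof.
move=> [f [g [fK gK cf cg]]].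
have -> : [set: X] = g @` setT by apply/seteqP; split=> // x _; exists (f x).
apply: continuous_compact; last exact: cantor_space_compact.
exact: continuous_subspaceT.
Qed.

Variable B : ordered_bratteli.
Hypothesis properB : properly_ordered B.
Hypothesis compactB : compact [set: path_space B].

(** Paths with longer and longer minimal initial parts accumulate at a minimal
  path only, and there is just one. *)
Lemma min_prefix_agrees (g : path_space B) (N : nat) : min_path g ->
  exists n, forall a : path_space B, (forall m, (m < n)%N -> min_edge (a m)) ->
    forall m, (m <= N)%N -> a m = g m.
Proof.
move=> ming; apply: contrapT => noN.
pose F n := [set a : path_space B | (forall m, (m < n)%N -> min_edge (a m)) /\
                     ~ forall m, (m <= N)%N -> a m = g m].
have [n|n|n|a _ Fa] := @compact_nested _ setT F compactB.
- apply: (@path_clopen _ (maxn n N) _ _).2 => a b ba [mina nag]; split.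
    by move=> m mn; rewrite ba; [exact: mina|rewrite leq_max ltnW].
  move=> bg; apply: nag => m mN.
  by rewrite -bg// ba// leq_max mN orbT.
- by move=> a [mina nag]; split; [move=> m mn; apply: mina; exact: ltnW|exact: nag].
- apply: contrapT => F0; apply: noN; exists n => a mina; apply: contrapT => nag.
  by apply: F0; exists a.
have [_ nag] := Fa 0%N; apply: nag => m _; congr (level _ m).
by apply: min_path_unique => // k; have [+ _] := Fa k.+1; apply.
Qed.

(** Off the maximal path the successor depends on finitely many edges and keeps
  the others.  Near the maximal path the successor starts with many minimal
  edges, so it is near the minimal path. *)
Lemma vershik_continuous : continuous (@vershik B).
Proof.
apply: path_continuous => a N.
have [[maxa minva]|[n ca]] := vershikP properB a.
- have [k kP] := min_prefix_agrees N minva; exists k => b ba.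
  apply: kP => m mk.
  have [[_ minb]//|[l [_ [lt _] minb _]]] := vershikP properB b.
  apply: minb; apply: leq_trans mk _; rewrite leqNgt; apply/negP => lk.
  by have := maxa l (vershik b l); rewrite -ba ?lt// ltnW.
- exists (maxn n N) => b ba m mN.
  have [c [clow chigh]] : exists c : path_space B,
      (forall m, (m <= maxn n N)%N -> c m = vershik a m) /\
      (forall m, (maxn n N < m)%N -> c m = b m).
    have := leq_maxl n N; rewrite leq_eqVlt => /orP[/eqP nN|nN].
      by apply: splice; rewrite ba// -nN; have [_ [/lt_edge_rng ->]] := ca.
    by apply: splice; rewrite ba//; have [_ _ _ <-] := ca.
  suff /(vershik_carries properB) -> : carries n b c.
    by rewrite clow// leq_max mN orbT.
  have [maxa next minc tail] := ca; split.
  + by move=> l ln; rewrite ba; [exact: maxa|rewrite leq_max ltnW].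
  + by rewrite ba ?clow// leq_maxl.
  + by move=> l ln; rewrite clow; [exact: minc|rewrite leq_max ltnW].
  + move=> l nl; have [lN|Nl] := leqP l (maxn n N).
      by rewrite ba// clow// tail.
    by rewrite chigh.
Qed.

End PathTopology.

Section Collapse.
Set Implicit Arguments.
Unset Strict Implicit.
Variables (B Bh : ordered_bratteli) (c : copy_pasting B Bh).
Hypotheses (properB : properly_ordered B) (properBh : properly_ordered Bh).

Lemma collapse_level (b : path_space Bh) n : collapse c b n = (elabel c (b n)).1.
Proof. by []. Qed.

Lemma collapse_continuous : continuous (collapse c).
Proof.
apply: path_continuous => a n; exists n => b ba m mn.
by rewrite !collapse_level ba.
Qed.

(** Copying a vertex copies all edges that end there.  This is why the labels
  preserve maximal, minimal and consecutive edges. *)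
Lemma elabel_lift n (eh : E Bh n) (e : E B n) :
  rng B e = rng B (elabel c eh).1 ->
  exists fh : E Bh n, elabel c fh = (e, (elabel c eh).2).
Proof.
move=> re; apply/elabel_range; rewrite re; apply/elabel_range.
by exists eh; rewrite -surjective_pairing.
Qed.

Lemma max_edge_elabel n (eh : E Bh n) : max_edge eh <-> max_edge (elabel c eh).1.
Proof.
split=> maxe f; apply/negP => lt.
- have [|fh fhP] := @elabel_lift n eh f; first by rewrite (lt_edge_rng lt).
  by have /negP := maxe fh; apply; apply/(elabel_lt c); rewrite fhP.
- by have /(elabel_lt c)[_] := lt; apply/negP/maxe.
Qed.

Lemma min_edge_elabel n (eh : E Bh n) : min_edge eh <-> min_edge (elabel c eh).1.
Proof.
split=> mine f; apply/negP => lt.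
- have [|fh fhP] := @elabel_lift n eh f; first by rewrite (lt_edge_rng lt).
  by have /negP := mine fh; apply; apply/(elabel_lt c); rewrite fhP.
- by have /(elabel_lt c)[_] := lt; apply/negP/mine.
Qed.

Lemma next_edge_elabel n (eh fh : E Bh n) :
  next_edge eh fh -> next_edge (elabel c eh).1 (elabel c fh).1.
Proof.
move=> [/(elabel_lt c)[eqj lt] next]; split=> // g eg; apply/negP => gf.
have [|gh ghP] := @elabel_lift n eh g; first by rewrite (lt_edge_rng eg).
have /next/negP : lt_edge eh gh by apply/(elabel_lt c); rewrite ghP.
by apply; apply/(elabel_lt c); rewrite ghP.
Qed.

Lemma carries_collapse n (a b : path_space Bh) :
  carries n a b -> carries n (collapse c a) (collapse c b).
Proof.
move=> [maxa next minb tail]; split=> [m mn||m mn|m nm].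
- exact/max_edge_elabel/maxa.
- exact: next_edge_elabel.
- exact/min_edge_elabel/minb.
- by rewrite !collapse_level tail.
Qed.

Lemma collapse_vershik (a : path_space Bh) :
  collapse c (vershik a) = vershik (collapse c a).
Proof.
have [[maxa minv]|[n ca]] := vershikP properBh a.
- apply/esym/vershik_max => // m; first exact/max_edge_elabel/maxa.
  exact/min_edge_elabel/minv.
- by apply/esym/(vershik_carries properB); exact: carries_collapse ca.
Qed.

Lemma collapse_iter n (a : path_space Bh) :
  collapse c (iter n (@vershik Bh) a) = iter n (@vershik B) (collapse c a).
Proof. by elim: n => //= n IH; rewrite collapse_vershik IH. Qed.

Hypothesis compactBh : compact [set: path_space Bh].

(** Two paths in one fibre pass simultaneously through the bottom of high
  towers, where both are close to the unique minimal path. *)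
Lemma fibre_gaps (a b : path_space Bh) (n : nat) : collapse c a = collapse c b ->
  exists r, forall i, (i < n)%N ->
    iter (r + i) (@vershik Bh) a 0%N = iter (r + i) (@vershik Bh) b 0%N.
Proof.
move=> ab; have [_ [g [ming _]]] := properBh.
have near_g : nbhs g [set x : path_space Bh | forall i, (i < n)%N ->
    iter i (@vershik Bh) x 0%N = iter i (@vershik Bh) g 0%N].
  elim: n => [|n IH]; first by apply: filterS (filterT) => x _ [].
  have cyl : nbhs g (iter n (@vershik Bh) @^-1`
      (@cylinder Bh (iter n (@vershik Bh) g, 0%N))).
    apply: (continuous_iter (vershik_continuous properBh compactBh)).
    by apply/nbhs_pathE; exists 0%N.
  apply: filterS2 IH cyl => x xlt /(_ 0%N) xn i.
  by rewrite ltnS leq_eqVlt => /orP[/eqP ->|/xlt//]; exact: xn.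
have [N NP] := (nbhs_pathE _ _).1 near_g.
have [k kP] := min_prefix_agrees properBh compactBh N ming.
have [r rP] := orbit_reaches_min properB k (collapse c a).
exists r => i iltn; rewrite ![(r + i)%N]addnC !iterD.
rewrite (NP (iter r (@vershik Bh) a))//; last first.
  by apply: kP => m mk; apply/min_edge_elabel; have := rP m mk; rewrite -collapse_iter.
rewrite (NP (iter r (@vershik Bh) b))//.
by apply: kP => m mk; apply/min_edge_elabel; have := rP m mk; rewrite ab -collapse_iter.
Qed.

End Collapse.

Section Pairs.
Set Implicit Arguments.
Unset Strict Implicit.
Variables (R : realType) (B Bh : ordered_bratteli) (T : extension_triple B Bh).

Let properB : properly_ordered B. Proof. by case: (triple_base T). Qed.
Let properBh : properly_ordered Bh. Proof. by case: (triple_ext T). Qed.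
Let compactBh : compact [set: path_space Bh].
Proof. by case: (triple_ext T) => _ _ /cantor_set_compact. Qed.

(** The system of pairs is taken on the whole product, with the fibre product as
  a compact invariant subset, so that no subspace topology is needed. *)
Definition pair_vershik (p : path_space Bh * path_space Bh) :=
  (vershik p.1, vershik p.2).
Definition split_pairs : set (path_space Bh * path_space Bh) :=
  [set p : path_space Bh * path_space Bh | p.1 0%N <> p.2 0%N].
Definition fibre_pairs : set (path_space Bh * path_space Bh) :=
  [set p | collapse T p.1 = collapse T p.2].

Lemma iter_pair_vershik n p :
  iter n pair_vershik p = (iter n (@vershik Bh) p.1, iter n (@vershik Bh) p.2).
Proof. by elim: n => [|n /= ->]; first case: p. Qed.

Lemma pair_vershik_continuous : continuous pair_vershik.
Proof.
move=> p.
have c1 : vershik q.1 @[q --> p] --> vershik p.1.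
  apply: continuous_comp; first exact: cvg_fst.
  exact: (vershik_continuous properBh compactBh).
have c2 : vershik q.2 @[q --> p] --> vershik p.2.
  apply: continuous_comp; first exact: cvg_snd.
  exact: (vershik_continuous properBh compactBh).
exact: (cvg_pair c1 c2).
Qed.

Lemma pair_clopen (n : nat) (A : set (path_space Bh * path_space Bh)) :
  (forall p q : path_space Bh * path_space Bh,
     (forall m, (m <= n)%N -> q.1 m = p.1 m) ->
     (forall m, (m <= n)%N -> q.2 m = p.2 m) -> A p -> A q) -> clopen A.
Proof.
move=> detA.
have near_pair (p : path_space Bh * path_space Bh) :
    nbhs p [set q : path_space Bh * path_space Bh |
      (forall m, (m <= n)%N -> q.1 m = p.1 m) /\
      (forall m, (m <= n)%N -> q.2 m = p.2 m)].
  by exists (@cylinder Bh (p.1, n), @cylinder Bh (p.2, n)) => //; split;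
    apply/nbhs_pathE; exists n.
split.
  by rewrite openE => p Ap; apply: filterS (near_pair p) => q [q1 q2]; exact: detA Ap.
rewrite -openC openE => p nAp; apply: filterS (near_pair p) => q [q1 q2] Aq.
by apply: nAp; apply: detA Aq => m mn; rewrite ?q1 ?q2.
Qed.

Lemma split_pairs_clopen : clopen split_pairs.
Proof. by apply: (@pair_clopen 0) => p q q1 q2; rewrite /split_pairs /= q1// q2. Qed.

Lemma fibre_pairs_compact : compact fibre_pairs.
Proof.
apply: (@subclosed_compact _ _ setT) => //; last first.
  by rewrite -setXTT; exact: compact_setX.
have -> : fibre_pairs = \bigcap_n [set p | collapse T p.1 n = collapse T p.2 n].
  apply/seteqP; split=> [p pY n _|p pY]; first by rewrite /mkset pY.
  by apply: path_ext => n; exact: pY.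
apply: closed_bigI => n _; apply: (@pair_clopen n _ _).2 => p q q1 q2.
by rewrite /mkset !collapse_level q1// q2.
Qed.

Lemma pair_vershik_fibre p : fibre_pairs p -> fibre_pairs (pair_vershik p).
Proof. by rewrite /fibre_pairs /= !collapse_vershik// => ->. Qed.

Lemma pair_gaps p : fibre_pairs p -> forall n : nat,
  exists r, forall i, (i < n)%N -> ~ split_pairs (iter (r + i) pair_vershik p).
Proof.
move=> pY n; have [r rP] := fibre_gaps properB properBh compactBh n pY.
by exists r => i iltn; rewrite iter_pair_vershik /split_pairs /= rP.
Qed.

Lemma discrepancyE :
  discrepancy T = (fun p => collapse T p.1) @` (fibre_pairs `&` split_pairs).
Proof.
apply/seteqP; split=> a.
  move=> [b [b' [ba b'a bb']]]; exists (b, b') => //.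
  by split=> //; rewrite /fibre_pairs /= ba.
by move=> [p [pY pK] <-]; exists p.1, p.2; split.
Qed.

Lemma discrepancy_compact : compact (discrepancy T).
Proof.
rewrite discrepancyE; apply: continuous_compact.
  apply: continuous_subspaceT => p; apply: continuous_comp; first exact: cvg_fst.
  exact: collapse_continuous.
by apply: compact_closedI; [exact: fibre_pairs_compact|case: split_pairs_clopen].
Qed.

(** A pair found in the fibre at time i is pulled back to time 0: the Vershik map
  is onto above and injective below. *)
Lemma discrepancy_pair i (a : path_space B) :
  discrepancy T (iter i (@vershik B) a) ->
  exists p, [/\ fibre_pairs p, p.1 <> p.2 & collapse T p.1 = a].
Proof.
move=> [d [d' [da d'a dd']]].
have [b bd] := iter_vershik_surj properBh i d.
have [b' b'd'] := iter_vershik_surj properBh i d'.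
have ba : collapse T b = a.
  by apply: (iter_vershik_inj properB (n := i)); rewrite -collapse_iter// bd.
have b'a : collapse T b' = a.
  by apply: (iter_vershik_inj properB (n := i)); rewrite -collapse_iter// b'd'.
exists (b, b'); split=> //=; first by rewrite /fibre_pairs /= ba.
by move=> bb'; apply: dd'; rewrite -bd -b'd' bb'.
Qed.

Hypothesis two_to_one : forall a : path_space B,
  (collapse T @^-1` [set a] #<= `I_2)%card.

Lemma fibre_two b b' d : collapse T b = collapse T d -> collapse T b' = collapse T d ->
  b <> b' -> d = b \/ d = b'.
Proof.
move=> bd b'd bb'; have /pcard_leP[f] := two_to_one (collapse T d).
have inj x y : collapse T x = collapse T d -> collapse T y = collapse T d ->
    f x = f y -> x = y.
  by move=> xd yd; apply: (@inj _ _ _ f); rewrite inE.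
have lt2 x : collapse T x = collapse T d -> (f x < 2)%N.
  by move=> xd; have := @funS _ _ _ _ f x xd.
have fb := lt2 b bd; have fb' := lt2 b' b'd; have fd := lt2 d erefl.
have fbb' : f b <> f b' by move=> /inj; move/(_ bd b'd).
have [e|e] : f d = f b \/ f d = f b' by lia.
- by left; exact: inj e.
- by right; exact: inj e.
Qed.

(** The images of p are two different points of the fibre at time i, so they
  are the whole fibre; only their level-0 edges can witness a discrepancy. *)
Lemma split_discrepancy p i : fibre_pairs p -> p.1 <> p.2 ->
  split_pairs (iter i pair_vershik p) <->
  discrepancy T (iter i (@vershik B) (collapse T p.1)).
Proof.
move=> pY np; rewrite iter_pair_vershik /split_pairs /=; split.
  move=> nii; exists (iter i (@vershik Bh) p.1), (iter i (@vershik Bh) p.2).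
  by split=> //; rewrite collapse_iter// pY.
move=> [d [d' [da d'a dd']]] eqi.
pose b := iter i (@vershik Bh) p.1; pose b' := iter i (@vershik Bh) p.2.
have bb' : b <> b' by move=> /(iter_vershik_inj properBh).
have bE : collapse T b = iter i (@vershik B) (collapse T p.1) by rewrite collapse_iter.
have b'E : collapse T b' = iter i (@vershik B) (collapse T p.1).
  by rewrite collapse_iter// pY.
have [||ed|ed] := @fibre_two b b' d _ _ bb'; rewrite ?bE ?b'E ?da//.
- have [||ed'|ed'] := @fibre_two b b' d' _ _ bb'; rewrite ?bE ?b'E ?d'a//;
  by apply: dd'; rewrite ed ed'.
- have [||ed'|ed'] := @fibre_two b b' d' _ _ bb'; rewrite ?bE ?b'E ?d'a//;
  by apply: dd'; rewrite ed ed'.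
Qed.

Lemma visits_pair n p : fibre_pairs p -> p.1 <> p.2 ->
  visits pair_vershik split_pairs n p =
  visits (@vershik B) (discrepancy T) n (collapse T p.1).
Proof.
move=> pY np; apply: eq_bigr => i _; congr (nat_of_bool _).
by apply/idP/idP => /set_mem /(split_discrepancy i pY np) /mem_set.
Qed.

Lemma birkhoff_averageE n a :
  birkhoff_average R T n a = n%:R^-1 * (visits (@vershik B) (discrepancy T) n a)%:R.
Proof. by rewrite /birkhoff_average /visits natr_sum; congr (_ * _). Qed.

(** All paths over a minimal path are minimal, so there is at most one. *)
Lemma min_path_no_discrepancy a i : min_path a -> ~ discrepancy T (iter i (@vershik B) a).
Proof.
move=> mina /discrepancy_pair[p [pY np pa]]; apply: np.
have lift (b : path_space Bh) : collapse T b = a -> min_path b.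
  by move=> ba m; apply/(min_edge_elabel T); have := mina m; rewrite -ba.
by apply: min_path_unique => //; apply: lift => //; rewrite -pY.
Qed.

End Pairs.

(** * Extending finitely additive set functions from clopen sets *)

(** A type of its own, so that its canonical algebra of measurable sets can be
  that of the clopen sets. *)
Definition clopen_algebra (X : ptopologicalType) : Type := X.

HB.instance Definition _ (X : ptopologicalType) :=
  Pointed.copy (clopen_algebra X) X.

Lemma clopen_setU (X : ptopologicalType) : setU_closed (@clopen X).
Proof. by move=> A B cA cB; exact: clopenU. Qed.

Lemma clopen_setC (X : ptopologicalType) : setC_closed (@clopen X).
Proof. by move=> A cA; exact: clopenC. Qed.

HB.instance Definition _ (X : ptopologicalType) :=
  @isAlgebraOfSets.Build default_measure_display (clopen_algebra X)
    (@clopen X) (@clopen0 X) (@clopen_setU X) (@clopen_setC X).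

Section ClopenExtension.
Set Implicit Arguments.
Unset Strict Implicit.
Variables (R : realType) (X : ptopologicalType) (m : set X -> R).
Hypothesis compactX : compact [set: X].
Hypothesis open_clopen : forall U : set X, open U ->
  exists2 F : nat -> set X, (forall n, clopen (F n)) & U = \bigcup_n F n.
Hypothesis m_ge0 : forall A, 0 <= m A.
Hypothesis mT : m setT = 1.
Hypothesis mU : forall A B, A `&` B = set0 -> m (A `|` B) = m A + m B.

Let m0 : m set0 = 0.
Proof. by have := mU (setI0 set0); rewrite setU0; lra. Qed.

Lemma additive_le A B : A `<=` B -> m A <= m B.
Proof.
move=> AB; rewrite -(setDUK AB) mU ?lerDl//.
by rewrite setDE setICA setICr setI0.
Qed.

Lemma additive_cover_le n A (F : nat -> set X) : A `<=` \bigcup_(i in `I_n) F i ->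
  m A <= \sum_(i < n) m (F i).
Proof.
elim: n A => [|n IH] A AF.
  rewrite big_ord0 -m0; apply: additive_le => x /AF[i]; by rewrite /= ltn0.
rewrite big_ord_recr/= -(setUIDK A (F n)) setUC mU; last first.
  by apply/seteqP; split=> x // -[[_ nFx] [_ /nFx]].
apply: lerD; last by apply: additive_le => x [].
apply: IH => x [/AF[i /= + Fx] nFx]; rewrite ltnS leq_eqVlt.
by case/orP => [/eqP e|lt]; [subst i|exists i].
Qed.

Lemma compact_finite_cover (K : set X) (F : nat -> set X) :
  compact K -> (forall n, clopen (F n)) -> K `<=` \bigcup_n F n ->
  exists n, K `<=` \bigcup_(i in `I_n) F i.
Proof.
move=> cK clF KF; apply: contrapT => nK.
have [n|n|n|x Kx Fx] := @compact_nested _ K (fun n => \bigcap_(i in `I_n) ~` F i) cK.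
- by apply: closed_bigI => i _; apply: open_closedC; case: (clF i).
- by move=> x Fx i /= iltn; apply: Fx => /=; exact: ltnW.
- apply: contrapT => nex; apply: nK; exists n => x Kx; apply: contrapT => nFx.
  by apply: nex; exists x; split=> // i iltn Fix; apply: nFx; exists i.
by have [i _ Fix] := KF x Kx; apply: (Fx i.+1 i) => /=.
Qed.

Let mu (A : set (clopen_algebra X)) : \bar R := (m A)%:E.

Let mu_ge0 A : (0 <= mu A)%E.
Proof. by rewrite lee_fin. Qed.

Let mu_additive : measure_function.semi_additive mu.
Proof. by apply/additive2P; rewrite /mu ?m0// => A B _ _ AB; rewrite mU. Qed.

HB.instance Definition _ := isContent.Build _ _ _ mu mu_ge0 mu_additive.

(** A countable clopen cover of a clopen set is essentially finite, so countable
  subadditivity comes for free. *)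
Let mu_sigma_subadditive : measurable_subset_sigma_subadditive mu.
Proof.
move=> A F clF clA AF; have cA : compact (A : set X).
  by apply: subclosed_compact compactX _ => //; case: clA.
have [n An] := compact_finite_cover cA clF AF.
apply: (@le_trans _ _ (\sum_(0 <= i < n) mu (F i))%E).
  by rewrite big_mkord sumEFin lee_fin; exact: additive_cover_le.
exact: nneseries_lim_ge.
Qed.

HB.instance Definition _ :=
  Content_SigmaSubAdditive_isMeasure.Build _ _ _ mu mu_sigma_subadditive.

(** The outer measure itself, read on the sigma-algebra generated by open sets
  instead of clopen sets. *)
Let P (A : set (g_sigma_algebraType (@open X))) : \bar R := (mu^*)%mu A.

Lemma borel_clopen : <<s @open X >> `<=` <<s @clopen X >>.
Proof.
apply: smallest_sub; first exact: smallest_sigma_algebra.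
move=> U /open_clopen[F clF ->].
apply: sigma_algebra_bigcup => n; exact: sub_sigma_algebra.
Qed.

Let P0 : P set0 = 0%E. Proof. exact: mu_ext0. Qed.

Let P_ge0 A : (0 <= P A)%E. Proof. exact: mu_ext_ge0. Qed.

Let P_sigma_additive : semi_sigma_additive P.
Proof.
move=> F mF tF mUF.
apply: (@measure_semi_sigma_additive _ _ _ (measure_extension mu) F) => //.
- by move=> i; apply: borel_clopen; exact: mF.
- by apply: borel_clopen; exact: mUF.
Qed.

HB.instance Definition _ := isMeasure.Build _ _ _ P P0 P_ge0 P_sigma_additive.

Let PT : P setT = 1%E.
Proof.
have -> : P setT = mu setT by apply: measurable_mu_extE; exact: clopenT.
by rewrite /mu mT.
Qed.

HB.instance Definition _ := Measure_isProbability.Build _ _ _ P PT.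

(** Both properties are read off clopen covers: those of a compact set reduce to
  a single clopen superset, and those of A pull back to covers of its preimage.
  The latter gives one inequality, and complements give the other, by
  measurability. *)
Lemma clopen_extension : exists Q : probability (g_sigma_algebraType (@open X)) R,
  (forall K s, compact K -> (forall C, clopen C -> K `<=` C -> s <= m C) ->
     (s%:E <= Q K)%E) /\
  (forall f : X -> X, continuous f -> (forall C, clopen C -> m (f @^-1` C) = m C) ->
     forall A : set (g_sigma_algebraType (@open X)), measurable A ->
     measurable (f @^-1` A : set (g_sigma_algebraType (@open X))) ->
     Q (f @^-1` A) = Q A).
Proof.
exists P; split=> [K s cK sK|f cf mf A mA mfA].
  apply: le_ereal_inf_tmp => _ [F [clF KF] <-].
  have [n Kn] := compact_finite_cover cK clF KF.
  apply: (@le_trans _ _ (\sum_(0 <= i < n) mu (F i))%E); last exact: nneseries_lim_ge.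
  rewrite big_mkord sumEFin lee_fin.
  pose C : set X := \bigcup_(i in `I_n) F i.
  have clC : clopen C.
    rewrite /C bigcup_mkord; elim/big_ind : _ => //.
    - exact: clopen0.
    - exact: clopen_setU.
    - by move=> i _; exact: clF.
  by apply: (@le_trans _ _ (m C)); [exact: sK|exact: additive_cover_le].
have le A' : (P (f @^-1` A') <= P A')%E.
  apply: le_ereal_inf_tmp => _ [F [clF AF] <-].
  apply: ereal_inf_lbound; exists (fun n => f @^-1` F n).
    split=> [n|x /AF[n _ Fx]]; last by exists n.
    exact: (preimage_clopen (clF n) cf).
  by apply: eq_eseriesr => n _; congr (_%:E); exact: mf (clF n).
apply/eqP; rewrite eq_le le /=.
have := le (~` A); rewrite preimage_setC.
have PC B : measurable B -> P (~` B) = (1 - P B)%E by exact: probability_setC.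
have fin B : measurable B -> P B \is a fin_num by exact: fin_num_measure.
rewrite !PC// -(fineK (fin _ mA)) -(fineK (fin _ mfA)) -!EFinB !lee_fin.
by rewrite lerD2l lerN2.
Qed.

End ClopenExtension.

(** * Empirical means and invariant measures *)

Section EmpiricalMean.
Set Implicit Arguments.
Unset Strict Implicit.
Variables (R : realType) (W : topologicalType) (T : W -> W) (a : W).
Variables (G : set_system nat).
Hypothesis ultraG : UltraFilter G.
Hypothesis Ginf : forall N, G [set n | (N <= n)%N].

Definition frequency (C : set W) (n : nat) : R := n%:R^-1 * (visits T C n a)%:R.

Lemma frequency_ge0 C n : 0 <= frequency C n.
Proof. by rewrite mulr_ge0 ?invr_ge0. Qed.

Lemma frequency_le1 C n : frequency C n <= 1.
Proof.
rewrite /frequency; case: n => [|n]; first by rewrite invr0 mul0r.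
by rewrite mulrC ler_pdivrMr// mul1r ler_nat visits_le.
Qed.

(** The frequencies have a cluster point in the unit interval, and along an
  ultrafilter a cluster point is a limit. *)
Lemma frequency_cvg C : cvg (frequency C @ G).
Proof.
have G01 : G (frequency C @^-1` `[0, 1]).
  apply: filterE => n; rewrite /preimage /mkset in_itv /=.
  by rewrite frequency_ge0 frequency_le1.
have [p [_ clp]] := @segment_compact R 0 1 (frequency C @ G) _ G01.
apply/cvg_ex; exists p => U Up.
have [//|nU] := in_ultra_setVsetC (frequency C @^-1` U) ultraG.
by have [x [nUx Ux]] := clp (~` U) U nU Up.
Qed.

Definition mean (C : set W) : R := lim (frequency C @ G).

Lemma mean_cvg C : frequency C @ G --> mean C.
Proof. exact: frequency_cvg. Qed.

Lemma mean_ge0 C : 0 <= mean C.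
Proof.
by apply: limr_ge (@frequency_cvg C) _; apply: filterE => n; exact: frequency_ge0.
Qed.

Lemma mean_setT : mean setT = 1.
Proof.
apply/cvg_lim => //; apply: cvg_near_cst; apply: filterS (Ginf 1) => n /= n0.
rewrite /frequency /visits (eq_bigr (fun=> 1%N)); last by move=> i _; rewrite mem_set.
by rewrite sum_nat_const card_ord muln1 mulVf// pnatr_eq0 -lt0n.
Qed.

Lemma mean_setU A B : A `&` B = set0 -> mean (A `|` B) = mean A + mean B.
Proof.
move=> AB; apply/cvg_lim => //.
have -> : frequency (A `|` B) = frequency A \+ frequency B.
  apply/funext => n; rewrite /frequency /= -mulrDr -natrD; congr (_ * _%:R).
  rewrite /visits -big_split; apply: eq_bigr => i _ /=; set x := iter _ _ _.
  rewrite in_setU; have [xA|xA] := boolP (x \in A); have [xB|xB] := boolP (x \in B) => //.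
  have : (A `&` B) x by split; exact: set_mem.
  by rewrite AB.
by apply: cvgD; exact: mean_cvg.
Qed.

(** Frequencies of C along the orbit and along the shifted orbit differ by at
  most 1/n. *)
Lemma mean_preimage C : mean (T @^-1` C) = mean C.
Proof.
apply/cvg_lim => //.
have -> : frequency (T @^-1` C) = frequency C \+
    (fun n => n%:R^-1 * ((iter n T a \in C)%:R - (a \in C)%:R)).
  apply/funext => n; rewrite /frequency /= -mulrDr; congr (_ * _).
  have : (visits T C n a + (iter n T a \in C) =
          visits T (T @^-1` C) n a + (a \in C))%N.
    elim: n => [|n IH]; first by rewrite !visits0.
    by rewrite !visitsS IH addnAC.
  move=> /(congr1 (fun k : nat => k%:R : R)); rewrite !natrD; lra.
rewrite -[X in _ --> X]addr0; apply: cvgD; first exact: mean_cvg.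
apply/cvgr0Pnorm_le => e e0; have := Ginf (Num.truncn e^-1).+1.
apply: filterS => n /= en; have n0 : (0 < n)%N by exact: leq_trans en.
rewrite normrM ger0_norm ?invr_ge0//.
have le1 : `|(iter n T a \in C)%:R - (a \in C)%:R| <= 1 :> R.
  by case: (_ \in _); case: (_ \in _);
    rewrite ?subrr ?subr0 ?sub0r ?normrN ?normr1 ?normr0.
apply: le_trans (_ : n%:R^-1 * 1 <= _); first by rewrite ler_wpM2l ?invr_ge0.
rewrite mulr1 invf_ple ?posrE ?ltr0n//.
by apply: ltW; apply: lt_le_trans (truncnS_gt _) _; rewrite ler_nat.
Qed.

Lemma mean_ge D C s : D `<=` C -> frequency D @ G --> s -> s <= mean C.
Proof.
move=> DC Ds; apply: (ler_cvg_to Ds (@mean_cvg C)); apply: filterE => n.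
rewrite ler_wpM2l ?invr_ge0// ler_nat; apply: leq_sum => i _.
by case: (boolP (_ \in D)) => // /set_mem /DC /mem_set ->.
Qed.

End EmpiricalMean.

Section InvariantMeasures.
Set Implicit Arguments.
Unset Strict Implicit.
Variables (R : realType).

Lemma preimage_borel (X : ptopologicalType) (f : X -> X)
    (A : set (g_sigma_algebraType (@open X))) :
  continuous f -> measurable A ->
  measurable (f @^-1` A : set (g_sigma_algebraType (@open X))).
Proof.
move=> cf; apply: (@smallest_sub _ (sigma_algebra setT) _
  [set A | measurable (f @^-1` A : set (g_sigma_algebraType (@open X)))]).
- split=> [|C mC|F mF]; rewrite /mkset.
  + by rewrite preimage_set0; exact: measurable0.
  + by rewrite setTD preimage_setC; exact: measurableC.
  + by rewrite preimage_bigcup; apply: bigcupT_measurable => i; exact: mF.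
- move=> U oU; apply: sub_sigma_algebra.
  by apply: open_comp => // x _; exact: cf.
Qed.

(** The sets F n consist of the points for which n edges show that they are in
  U. *)
Lemma open_path_clopen (B : bratteli) (U : set (path_space B)) : open U ->
  exists2 F : nat -> set (path_space B), (forall n, clopen (F n)) & U = \bigcup_n F n.
Proof.
move=> oU; exists (fun n => [set a : path_space B |
    forall b : path_space B, (forall m, (m <= n)%N -> b m = a m) -> U b]).
  move=> n; apply: (@path_clopen _ n) => a b ba aU c cb; apply: aU => m mn.
  by rewrite cb// ba.
apply/seteqP; split=> [a Ua|a [n _ aU]]; last exact: aU.
have [n nU] := (nbhs_pathE _ _).1 (open_nbhs_nbhs (conj oU Ua)).
by exists n.
Qed.

Variable B : ordered_bratteli.
Hypothesis properB : properly_ordered B.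
Hypothesis compactB : compact [set: path_space B].

(** The ultrafilter refines the filter along which the averages of D tend to s.
  A clopen superset of D is visited at least as often as D, so the mean of each
  such set is at least s. *)
Lemma invariant_measure_of_cluster (D : set (path_space B)) (s : R) (a : path_space B) :
  compact D -> density_cluster (@vershik B) D s a ->
  exists mu : probability (borel B) R, invariant_measure mu /\ (s%:E <= mu D)%E.
Proof.
move=> cD cl.
pose F := filter_from setT (fun k : nat => [set n | (k <= n)%N /\
  `|n%:R^-1 * (visits (@vershik B) D n a)%:R - s| < k.+1%:R^-1]).
have FF : ProperFilter F.
  apply: filter_from_proper.
    apply: filter_from_filter; first by exists 0%N.
    move=> i j _ _; exists (maxn i j) => // n /=; rewrite geq_max => -[/andP[i_n jn] d].
    by split; split=> //; apply: lt_le_trans d _;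
      rewrite lef_pV2 ?posrE// ler_nat ltnS ?leq_maxl ?leq_maxr.
  move=> k _; have k0 : 0 < k.+1%:R^-1 :> R by rewrite invr_gt0.
  by have [n kn dn] := cl _ k0 k; exists n.
have [G [ultraG FG]] := ultraFilterLemma FF.
have Ginf N : G [set n | (N <= n)%N].
  by apply: FG; exists N => // n [].
have Gs : frequency R (@vershik B) a D @ G --> s.
  apply/cvgrPdist_lt => e e0; apply: FG; exists (Num.truncn e^-1) => // n [_ dn].
  rewrite /= distrC; apply: lt_trans dn _.
  by rewrite invf_plt ?posrE// truncnS_gt.
have cv := vershik_continuous properB compactB.
pose m := mean R (@vershik B) a G.
have m_ge0 A : 0 <= m A by exact: mean_ge0.
have mT : m setT = 1 by exact: mean_setT.
have mU A A' : A `&` A' = set0 -> m (A `|` A') = m A + m A' by exact: mean_setU.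
have [P [Ps Pinv]] := clopen_extension compactB (@open_path_clopen B) m_ge0 mT mU.
exists P; split.
  move=> A mA; apply: Pinv => //; last exact: preimage_borel.
  by move=> C _; exact: mean_preimage.
by apply: Ps => // C _ DC; exact: mean_ge Gs.
Qed.

(** Integrate the visit count: each of its n terms has the integral [mu D]. *)
Lemma invariant_measure_le (mu : probability (borel B) R)
    (D : set (borel B)) (n k : nat) :
  invariant_measure mu -> measurable D ->
  (forall a, (visits (@vershik B) D n a <= k)%N) ->
  fine (mu D) * n%:R <= k%:R.
Proof.
move=> inv mD vk.
pose A i : set (borel B) := iter i (@vershik B) @^-1` D.
have cv := vershik_continuous properB compactB.
have mA i : measurable (A i) by apply: preimage_borel => //; exact: continuous_iter.
have muA i : mu (A i) = mu D.
  elim: i => [//|i <-]; rewrite -(inv _ (mA i)); congr (mu _).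
  by apply/funext => a; rewrite /A /preimage /mkset iterSr.
have : (\int[mu]_x (\sum_(i < n) (\1_(A i) x)%:E) <= \int[mu]_x (cst k%:R%:E x))%E.
  apply: ge0_le_integral => //.
  - by move=> x _; apply: sume_ge0 => i _; rewrite lee_fin.
  - apply: emeasurable_sum => i; apply/measurable_EFinP; exact: measurable_indic.
  - move=> x _; rewrite sumEFin lee_fin.
    apply: le_trans (_ : (visits (@vershik B) D n x)%:R <= _);
      last by rewrite ler_nat.
    by rewrite /visits natr_sum; apply: ler_sum => i _; rewrite indicE.
rewrite ge0_integral_sum//; last first.
  move=> i; apply/measurable_EFinP; exact: measurable_indic.
have intA i : (\int[mu]_x (\1_(A i) x)%:E = mu D)%E.
  by rewrite integral_indic// setIT; exact: muA.
under eq_bigr do rewrite intA.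
have muT : mu setT = 1%E by exact: probability_setT.
rewrite integral_cst//= muT mule1.
have finD : mu D \is a fin_num by exact: fin_num_measure.
by rewrite -(fineK finD) sumEFin lee_fin sumr_const card_ord mulr_natr.
Qed.

End InvariantMeasures.

(** * The Birkhoff spectrum *)

Section Spectrum.
Set Implicit Arguments.
Unset Strict Implicit.
Variables (R : realType) (B Bh : ordered_bratteli) (T : extension_triple B Bh).

Lemma birkhoff_spectrumE : birkhoff_spectrum R T =
  [set s | exists a, density_cluster (@vershik B) (discrepancy T) s a].
Proof.
apply/seteqP; split=> s.
  move=> [a _ cla]; exists a => e e0 N.
  have [x [[n Nn <-] xs]] := cla (maxn N 1) (leq_maxr _ _) _ (nbhsx_ballx s e e0).
  exists n; first by apply: leq_trans Nn; exact: leq_maxl.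
  by move: xs; rewrite birkhoff_averageE /ball /= distrC.
move=> [a cla]; exists a => // N /= N0 U /nbhs_ballP[e /= e0 eU].
have [n Nn dn] := cla e e0 N.
exists (birkhoff_average R T n a); split; first by exists n.
by apply: eU; rewrite /ball /= birkhoff_averageE distrC.
Qed.

Let properB : properly_ordered B. Proof. by case: (triple_base T). Qed.
Let compactB : compact [set: path_space B].
Proof. by case: (triple_base T) => _ _ /cantor_set_compact. Qed.

Lemma discrepancy_measurable : measurable (discrepancy T : set (borel B)).
Proof.
rewrite -[X in measurable X]setCK; apply: measurableC; apply: sub_sigma_algebra.
apply: closed_openC; apply: compact_closed; first exact: path_hausdorff.
exact: discrepancy_compact.
Qed.

Let density_set := [set fine (mu (discrepancy T)) |
  mu in [set mu : probability (borel B) R | invariant_measure mu]].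

Lemma density_set_ub : has_ubound density_set.
Proof.
exists 1 => _ [mu _ <-].
have mD := discrepancy_measurable.
have finD : mu (discrepancy T) \is a fin_num by exact: fin_num_measure.
by rewrite -lee_fin fineK// probability_le1.
Qed.

Lemma cluster_le_sup s a : density_cluster (@vershik B) (discrepancy T) s a ->
  0 <= s <= sup density_set.
Proof.
move=> cla; apply/andP; split.
  rewrite leNgt; apply/negP => s0.
  have ns0 : 0 < - s by rewrite oppr_gt0.
  have [n _] := cla _ ns0 0%N; rewrite ltr_norml => /andP[_].
  have : 0 <= n%:R^-1 * (visits (@vershik B) (discrepancy T) n a)%:R :> R.
    by rewrite mulr_ge0 ?invr_ge0.
  by lra.
have [mu [inv smu]] := invariant_measure_of_cluster properB compactB
  (@discrepancy_compact _ _ T) cla.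
apply: (@le_trans _ _ (fine (mu (discrepancy T)))).
  rewrite -lee_fin fineK//; apply: fin_num_measure; exact: discrepancy_measurable.
by apply: ub_le_sup; [exact: density_set_ub|exists mu].
Qed.

(** Counts at time n are bounded integers, so their maximum k is attained; every
  invariant measure of D is at most k / n. *)
Lemma visits_ge_of_sup s (n : nat) : 0 < s -> s <= sup density_set ->
  exists a, s * n%:R <= (visits (@vershik B) (discrepancy T) n a)%:R.
Proof.
move=> s0 ssup.
have [a0] := path_space_inhabited B.
pose Q k := `[< exists a, visits (@vershik B) (discrepancy T) n a = k >].
have exQ : exists k, Q k.
  by exists (visits (@vershik B) (discrepancy T) n a0); apply/asboolP; exists a0.
have Qn k : Q k -> (k <= n)%N by move=> /asboolP[a <-]; exact: visits_le.
case: (ex_maxnP exQ Qn) => k /asboolP[a ak] maxk; exists a; rewrite ak.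
have [->|n0] := posnP n; first by rewrite mulr0.
have n0R : 0 < n%:R :> R by rewrite ltr0n.
rewrite -ler_pdivlMr//; apply: (@le_trans _ _ (sup density_set)) => //; apply: ge_sup.
  apply/set0P/eqP => M0; move: ssup; rewrite M0 sup0; lra.
move=> _ [mu inv <-]; rewrite ler_pdivlMr//.
apply: invariant_measure_le => //; first exact: discrepancy_measurable.
by move=> b; apply: maxk; apply/asboolP; exists b.
Qed.

Hypothesis two_to_one : forall a : path_space B,
  (collapse T @^-1` [set a] #<= `I_2)%card.

Lemma cluster_of_le_sup s : 0 <= s -> s <= sup density_set ->
  exists a, density_cluster (@vershik B) (discrepancy T) s a.
Proof.
rewrite le_eqVlt => /orP[/eqP <- _|s0 ssup].
  (* For s = 0 the orbit of the minimal path never meets the discrepancy set. *)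
  have [_ [g [ming _]]] := properB; exists g => e e0 N; exists N => //.
  rewrite visits_gap ?mulr0 ?subrr ?normr0// => i _.
  exact: min_path_no_discrepancy.
have exY n : exists2 p, fibre_pairs T p &
    s * n%:R <= (visits (@pair_vershik Bh) (@split_pairs Bh) n p)%:R.
  have [n0|n0] := posnP n.
    by have [x] := path_space_inhabited Bh; exists (x, x) => //; rewrite n0 mulr0.
  have [a sa] := visits_ge_of_sup n s0 ssup.
  have [i Di] : exists i, discrepancy T (iter i (@vershik B) a).
    apply: contrapT => nD; move: sa; rewrite visits_gap => [|i _ Di].
      by rewrite leNgt mulr_gt0// ltr0n.
    by apply: nD; exists i.
  have [p [pY np pa]] := discrepancy_pair Di.
  by exists p => //; rewrite (visits_pair two_to_one)// pa.
have cT := @pair_vershik_continuous _ _ T.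
have [oK cK] := @split_pairs_clopen Bh.
have cY := @fibre_pairs_compact _ _ T.
have TY := @pair_vershik_fibre _ _ T.
have [p pY cl] := density_cluster_exists cT oK cK cY TY (@pair_gaps _ _ T) (ltW s0)
  (dense_orbit_exists cT oK cK cY TY (ltW s0) exY).
(* A diagonal pair never splits, and its averages tend to 0, not to s. *)
have np : p.1 <> p.2.
  move=> p12; have [n _] := cl s s0 0%N; rewrite visits_gap.
    by rewrite mulr0 sub0r normrN gtr0_norm// ltxx.
  by move=> i _; rewrite iter_pair_vershik /split_pairs /= p12.
exists (collapse T p.1) => e e0 N; have [n Nn dn] := cl e e0 N.
by exists n => //; rewrite -(visits_pair two_to_one).
Qed.

End Spectrum.

Theorem theorem4p9 (R : realType) (B Bh : ordered_bratteli)
    (T : extension_triple B Bh)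
    (two_to_one : forall a : path_space B,
      (collapse T @^-1` [set a] #<= `I_2)%card) :
  birkhoff_spectrum R T =
  `[0, sup [set fine (mu (discrepancy T)) |
             mu in [set mu : probability (borel B) R |
                    invariant_measure mu]]]%classic.
Proof.
rewrite birkhoff_spectrumE; apply/seteqP; split=> s; rewrite /= in_itv /=.
  by move=> [a /cluster_le_sup].
by move=> /andP[s0 ssup]; exact: cluster_of_le_sup.
Qed.
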